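(* (i) For every uniformly highly computable sequence $(G_e)_{e\in\mathbb{N}}$ of connected, locally finite multigraphs each of which has exactly one end, the set $\{e\in\mathbb{N} : G_e \text{ admits a one-way infinite Eulerian path}\}$ is $\Sigma_2^{-1}$. (ii) For every $\Sigma_2^{-1}$ set $W\subseteq\mathbb{N}$ there is a uniformly highly computable sequence $(G_e)_{e\in\mathbb{N}}$ of connected, locally finite multigraphs each having exactly one end such that $W=\{e\in\mathbb{N} : G_e \text{ admits a one-way infinite Eulerian path}\}$. In particular, deciding whether a highly computable graph with one end admits a one-way Eulerian path is $\Sigma_2^{-1}$-complete (with respect to many-one reductions).
   Context: Multigraphs are undirected, may have loops and multiple edges; the degree of a vertex is the number of incident edges, loops counted twice. A multigraph $G$ is computable if $V(G)$ is a decidable subset of $\mathbb{N}$ and the function $(u,v)\mapsto$ (number of edges joining $u$ and $v$) is computable; it is highly computable if moreover it is locally finite (every vertex has finite degree) and the degree function $V(G)\to\mathbb{N}$ is computable. A sequence $(G_e)_{e\in\mathbb{N}}$ is uniformly highly computable if there are computable functions $V(e,v)$, $E(e,u,v)$, $\deg(e,v)$ giving, uniformly in $e$, membership in $V(G_e)$, the number of edges joining $u,v$ in $G_e$, and the degree of $v$ in $G_e$. For a connected locally finite multigraph $G$, the number of ends of $G$ is the supremum, over all finite sets $F$ of edges, of the number of infinite connected components of $G\smallsetminus F$ (the multigraph with the edges of $F$ removed). A one-way infinite Eulerian path is a sequence $v_0,v_1,\dots$ of vertices together with edges $e_n$ joining $v_n$ and $v_{n+1}$ such that every edge of $G$ equals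 $e_n$ for exactly one $n\in\mathbb{N}$. A set $A\subseteq\mathbb{N}$ is $\Sigma_2^{-1}$ (2-c.e.) if there is a computable $f:\mathbb{N}^2\to\{0,1\}$ with $f(x,0)=0$... more precisely, with $A(x)=\lim_s f(x,s)$ and $|\{s: f(x,s)\neq f(x,s+1)\}|\le 2$ for all $x$; equivalently $A=A_1\smallsetminus A_2$ for c.e. sets $A_1\supseteq A_2$. *)

(* Defs.v *)
From mathcomp Require Import all_boot.
From mathcomp Require Import boolp classical_sets functions cardinality.
From Stdlib Require Import Relation_Operators.
Set Implicit Arguments.
Unset Strict Implicit.
Unset Printing Implicit Defensive.
Local Open Scope classical_set_scope.
Local Open Scope card_scope.

(* The total recursive functions in Kleene's sense: minimization is applied
   only to regular functions, so every member of the class is total. *)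
Inductive recursive : forall n : nat, (n.-tuple nat -> nat) -> Prop :=
| rec_zero n : recursive (fun _ : n.-tuple nat => 0)
| rec_succ : recursive (fun v : 1.-tuple nat => (thead v).+1)
| rec_proj n (i : 'I_n) : recursive (fun v : n.-tuple nat => tnth v i)
| rec_comp m n (f : m.-tuple nat -> nat) (g : 'I_m -> n.-tuple nat -> nat) :
    recursive f -> (forall i, recursive (g i)) ->
    recursive (fun v : n.-tuple nat => f [tuple g i v | i < m])
| rec_prim n (f : n.-tuple nat -> nat) (g : n.+2.-tuple nat -> nat)
    (h : n.+1.-tuple nat -> nat) :
    recursive f -> recursive g ->
    (forall v : n.-tuple nat, h [tuple of 0 :: v] = f v) ->
    (forall k (v : n.-tuple nat), h [tuple of k.+1 :: v] =
       g [tuple of k :: h [tuple of k :: v] :: v]) ->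
    recursive h
| rec_mu n (f : n.+1.-tuple nat -> nat) (h : n.-tuple nat -> nat) :
    recursive f ->
    (forall v : n.-tuple nat, f [tuple of h v :: v] = 0) ->
    (forall (v : n.-tuple nat) k, k < h v -> f [tuple of k :: v] <> 0) ->
    recursive h
| rec_ext n (f g : n.-tuple nat -> nat) : f =1 g -> recursive f -> recursive g.

Definition computable1 (f : nat -> nat) : Prop :=
  recursive (fun v : 1.-tuple nat => f (nth 0 v 0)).
Definition computable2 (f : nat -> nat -> nat) : Prop :=
  recursive (fun v : 2.-tuple nat => f (nth 0 v 0) (nth 0 v 1)).
Definition computable3 (f : nat -> nat -> nat -> nat) : Prop :=
  recursive (fun v : 3.-tuple nat => f (nth 0 v 0) (nth 0 v 1) (nth 0 v 2)).

(* [mult u v] is the number of edges joining u and v; [mult u u] is the number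
   of loops at u. No computability is assumed of [vert] and [mult]. *)
Record multigraph : Type := Multigraph {
  vert : pred nat;
  mult : nat -> nat -> nat;
  mult_sym : forall u v, mult u v = mult v u;
  mult_vert : forall u v, 0 < mult u v -> vert u
}.

(* (u, v, i) with u <= v stands for the i-th of the edges joining u and v. *)
Definition edge : Type := (nat * nat * nat)%type.

Definition edges (G : multigraph) : set edge :=
  [set x | x.1.1 <= x.1.2 /\ x.2 < mult G x.1.1 x.1.2].

Definition joins (x : edge) (u v : nat) : Prop :=
  x.1 = (u, v) \/ x.1 = (v, u).

(* All neighbours of v lie below N; the final summand makes loops count twice. *)
Definition has_degree (G : multigraph) (v d : nat) : Prop :=
  exists N, (forall w, N <= w -> mult G v w = 0) /\
            d = \sum_(w < N) mult G v w + mult G v v.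

Definition locally_finite (G : multigraph) : Prop :=
  forall v, vert G v -> exists d, has_degree G v d.

Definition adjacent_off (G : multigraph) (F : set edge) (u v : nat) : Prop :=
  exists x, [/\ edges G x, ~ F x & joins x u v].

(* The connected component of v in the multigraph G with the edges F removed. *)
Definition component (G : multigraph) (F : set edge) (v : nat) : set nat :=
  [set w | clos_refl_trans nat (adjacent_off G F) v w].

Definition infinite_components (G : multigraph) (F : set edge) : set (set nat) :=
  [set C | infinite_set C /\ exists2 v, vert G v & C = component G F v].

Definition connected (G : multigraph) : Prop :=
  forall u v, vert G u -> vert G v -> component G set0 u v.

(* The supremum of the numbers of infinite components, over all finite sets of
   edges removed, equals n. *)
Definition number_of_ends (G : multigraph) (n : nat) : Prop :=
  (forall F : set edge, finite_set F -> F `<=` edges G ->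
     infinite_components G F #<= `I_n) /\
  (exists F : set edge, [/\ finite_set F, F `<=` edges G &
     `I_n #<= infinite_components G F]).

Definition one_way_eulerian_path (G : multigraph)
    (v : nat -> nat) (x : nat -> edge) : Prop :=
  (forall n, edges G (x n) /\ joins (x n) (v n) (v n.+1)) /\
  (forall y, edges G y -> exists! n, x n = y).

Definition one_way_eulerian (G : multigraph) : Prop :=
  exists v x, one_way_eulerian_path G v x.

Definition uniformly_highly_computable (G : nat -> multigraph) : Prop :=
  (forall e, locally_finite (G e)) /\
  exists (V : nat -> nat -> nat) (E : nat -> nat -> nat -> nat)
         (deg : nat -> nat -> nat),
    [/\ computable2 V, computable3 E & computable2 deg] /\
    [/\ forall e v, V e v = nat_of_bool (vert (G e) v),
        forall e u v, E e u v = mult (G e) u v &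
        forall e v, vert (G e) v -> has_degree (G e) v (deg e v)].

(* Normalized by f x 0 = 0; without it the class would be larger than that of
   the differences of c.e. sets. *)
Definition Sigma2inv (A : set nat) : Prop :=
  exists f : nat -> nat -> bool,
    [/\ computable2 (fun x s => nat_of_bool (f x s)),
        forall x, f x 0 = false,
        forall x, exists s0, forall s, s0 <= s -> (f x s <-> A x) &
        forall x, [set s | f x s <> f x s.+1] #<= `I_2].

Definition many_one_reducible (A B : set nat) : Prop :=
  exists2 g : nat -> nat, computable1 g & forall x, A x <-> B (g x).

Definition Sigma2inv_complete (A : set nat) : Prop :=
  Sigma2inv A /\ forall B, Sigma2inv B -> many_one_reducible B A.

(* Main.v *)
Require Import Defs.
From mathcomp Require Import all_boot.
From mathcomp Require Import boolp classical_sets functions cardinality.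
From mathcomp Require Import zify.
From Stdlib Require Import Relation_Operators.
Set Implicit Arguments.
Unset Strict Implicit.
Unset Printing Implicit Defensive.
Local Open Scope classical_set_scope.
Local Open Scope card_scope.

(**
A connected locally finite graph with one end has a one-way infinite Eulerian
path iff exactly one vertex has odd degree. Necessity is a parity count. For
sufficiency one extends finite trails T from the odd vertex, keeping the
remaining edges connected to the end of T. To absorb a given edge, continue T by
a trail P through it: by the handshake lemma the component of the end of P is
infinite, so by one-endedness the other components are finite, and with P they
form a finite connected graph having an Eulerian trail with the same ends as P.

Hence (i): "at least one odd vertex" and "at least two odd vertices" are c.e.
For (ii), put 2 - f e n parallel edges between n and n + 1 of a ray: its odd
vertices are the successors of the stages at which f e changes, and the limit of
f e is true iff there is exactly one change. Completeness follows from (ii)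
applied to a universal difference of c.e. sets; universality is obtained by
enumerating finite sets of facts "program c maps x to y" each of which follows
from others.
*)

(** * Recursive functions *)

(* Arguments are read from an environment [v : nat -> nat], so that binding a
   variable shifts the environment and variables stay of the form [v i]. *)
Definition recursive_env n (F : (nat -> nat) -> nat) : Prop :=
  recursive (fun t : n.-tuple nat => F (nth 0 t)).

Lemma recursive_env_ext n (F G : (nat -> nat) -> nat) :
  F =1 G -> recursive_env n F -> recursive_env n G.
Proof. by move=> FG; apply: rec_ext => t; exact: FG. Qed.

Lemma recursive_env_var n i : recursive_env n (fun v => v i).
Proof.
case: (ltnP i n) => [lt_in|le_ni].
  by apply: rec_ext (rec_proj (Ordinal lt_in)) => t; rewrite (tnth_nth 0).
by apply: rec_ext (rec_zero n) => t; rewrite nth_default // size_tuple.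
Qed.

Lemma recursive_env_comp m n F (G : nat -> (nat -> nat) -> nat) :
  recursive_env m F -> (forall i, i < m -> recursive_env n (G i)) ->
  (forall i (t : n.-tuple nat), m <= i -> G i (nth 0 t) = 0) ->
  recursive_env n (fun v => F (G^~ v)).
Proof.
move=> rF rG G0.
apply: (rec_ext _ (rec_comp rF (fun i : 'I_m => rG i (ltn_ord i)))) => t.
congr F; apply/funext => i; case: (ltnP i m) => [lt_im|le_mi].
  by rewrite -(tnth_nth 0 _ (Ordinal lt_im)) tnth_mktuple.
by rewrite nth_default ?size_tuple // G0.
Qed.

Lemma recursive_env_app1 n f F :
  computable1 f -> recursive_env n F -> recursive_env n (fun v => f (F v)).
Proof.
move=> rf rF; pose G i v := nth 0 [:: F v] i.
by apply: (@recursive_env_comp 1 n (fun v => f (v 0)) G) => // -[|[]].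
Qed.

Lemma recursive_env_app2 n f F1 F2 : computable2 f ->
  recursive_env n F1 -> recursive_env n F2 ->
  recursive_env n (fun v => f (F1 v) (F2 v)).
Proof.
move=> rf rF1 rF2; pose G i v := nth 0 [:: F1 v; F2 v] i.
by apply: (@recursive_env_comp 2 n (fun v => f (v 0) (v 1)) G) => // -[|[|[]]].
Qed.

Lemma recursive_env_prim n (F G H : (nat -> nat) -> nat) :
  recursive_env n F -> recursive_env n.+2 G ->
  (forall v, H (nth 0 (0 :: v)) = F (nth 0 v)) ->
  (forall k v, H (nth 0 (k.+1 :: v)) =
               G (nth 0 [:: k, H (nth 0 (k :: v)) & v])) ->
  recursive_env n.+1 H.
Proof.
move=> rF rG H0 HS.
by apply: (rec_prim rF rG) => [t|k t]; [exact: H0 | exact: HS].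
Qed.

Lemma computable1_succ : computable1 succn.
Proof. by apply: rec_ext rec_succ => t; rewrite /thead (tnth_nth 0). Qed.

Lemma recursive_env_const n k : recursive_env n (fun=> k).
Proof.
elim: k => [|k IHk]; first exact: rec_zero.
exact: recursive_env_app1 computable1_succ IHk.
Qed.

Lemma computable2_addn : computable2 addn.
Proof.
apply: (@recursive_env_prim 1 (fun v => v 0) (fun v => (v 1).+1)
  (fun v => v 0 + v 1)) => //; first exact: recursive_env_var.
exact: recursive_env_app1 computable1_succ (recursive_env_var _ _).
Qed.

Lemma computable2_muln : computable2 muln.
Proof.
apply: (@recursive_env_prim 1 (fun=> 0) (fun v => v 2 + v 1)
  (fun v => v 0 * v 1)) => //; first exact: recursive_env_const.
by apply: recursive_env_app2 computable2_addn _ _; exact: recursive_env_var.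
Qed.

Lemma computable1_pred : computable1 predn.
Proof.
apply: (@recursive_env_prim 0 (fun=> 0) (fun v => v 0) (fun v => (v 0).-1))
  => //.
  exact: recursive_env_const.
exact: recursive_env_var.
Qed.

Lemma computable2_subn : computable2 subn.
Proof.
have rsub : computable2 (fun x y => y - x).
  apply: (@recursive_env_prim 1 (fun v => v 0) (fun v => (v 1).-1)
    (fun v => v 1 - v 0)) => [| |v|k v].
  - exact: recursive_env_var.
  - exact: recursive_env_app1 computable1_pred (recursive_env_var _ _).
  - exact: subn0.
  - exact: subnS.
exact: (recursive_env_app2 rsub (recursive_env_var 2 1)
                                (recursive_env_var 2 0)).
Qed.

Lemma computable2_leq : computable2 (fun x y => x <= y).
Proof.
apply: (@recursive_env_ext 2 (fun v => 1 - (v 0 - v 1)) (fun v => v 0 <= v 1)).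
  by move=> v; lia.
exact: (recursive_env_app2 computable2_subn (recursive_env_const 2 1)
  (recursive_env_app2 computable2_subn (recursive_env_var 2 0)
                                       (recursive_env_var 2 1))).
Qed.

Lemma recursive_env_negb n (P : (nat -> nat) -> bool) :
  recursive_env n P -> recursive_env n (fun v => ~~ P v).
Proof.
move=> rP; apply: (@recursive_env_ext n (fun v => 1 - P v)) => [v|].
  by case: (P v).
exact: recursive_env_app2 computable2_subn (recursive_env_const _ _) rP.
Qed.

Lemma recursive_env_andb n (P Q : (nat -> nat) -> bool) :
  recursive_env n P -> recursive_env n Q ->
  recursive_env n (fun v => P v && Q v).
Proof.
move=> rP rQ; apply: (@recursive_env_ext n (fun v => P v * Q v)) => [v|].
  exact: mulnb.
exact: recursive_env_app2 computable2_muln rP rQ.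
Qed.

Lemma recursive_env_orb n (P Q : (nat -> nat) -> bool) :
  recursive_env n P -> recursive_env n Q ->
  recursive_env n (fun v => P v || Q v).
Proof.
move=> rP rQ; apply: (@recursive_env_ext n (fun v => ~~ (~~ P v && ~~ Q v))).
  by move=> v; rewrite negb_and !negbK.
by apply/recursive_env_negb/recursive_env_andb; exact: recursive_env_negb.
Qed.

Lemma computable2_eqn : computable2 (fun x y => x == y).
Proof.
apply: (@recursive_env_ext 2 (fun v => (v 0 <= v 1) && (v 1 <= v 0))
  (fun v => v 0 == v 1)) => [v|]; first by rewrite eqn_leq.
exact: (recursive_env_andb
  (recursive_env_app2 computable2_leq (recursive_env_var 2 0)
                                      (recursive_env_var 2 1))
  (recursive_env_app2 computable2_leq (recursive_env_var 2 1)
                                      (recursive_env_var 2 0))).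
Qed.

(* The value is [n] if no number below [n] satisfies [p]. *)
Definition least_below (n : nat) (p : pred nat) : nat := find p (iota 0 n).

Definition exists_below (n : nat) (p : pred nat) : bool := has p (iota 0 n).

Definition forall_below (n : nat) (p : pred nat) : bool := all p (iota 0 n).

Lemma exists_belowP n (p : pred nat) :
  reflect (exists2 k, k < n & p k) (exists_below n p).
Proof.
by apply: (iffP hasP) => -[k kn pk]; exists k; rewrite ?mem_iota // in kn *.
Qed.

Lemma forall_belowP n (p : pred nat) :
  reflect (forall k, k < n -> p k) (forall_below n p).
Proof.
by apply: (iffP allP) => np k kn; apply: np; rewrite ?mem_iota // in kn *.
Qed.

Lemma exists_belowS n p : exists_below n.+1 p = exists_below n p || p n.
Proof. by rewrite /exists_below -addn1 iotaD has_cat /= orbF. Qed.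

Lemma least_belowS n p :
  least_below n.+1 p = least_below n p + ((least_below n p == n) && ~~ p n).
Proof.
rewrite /least_below -addn1 iotaD find_cat /= has_find size_iota add0n.
have := find_size p (iota 0 n); rewrite size_iota.
by case: ltngtP => // [lt|->] _; rewrite ?addn0 //; case: (p n).
Qed.

Lemma least_below_unique n (p : pred nat) k : k < n ->
  (forall i, i < n -> p i = (k <= i)) -> least_below n p = k.
Proof.
move=> lt_kn pE.
have /hasP ex : exists2 i, i \in iota 0 n & p i.
  by exists k; rewrite ?mem_iota // pE.
have lt_fn : find p (iota 0 n) < n by rewrite -{2}(size_iota 0 n) -has_find.
have := nth_find 0 ex; rewrite nth_iota // pE // => le_kf.
apply/eqP; rewrite eqn_leq le_kf andbT leqNgt; apply/negP => /(before_find 0).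
by rewrite nth_iota // pE // leqnn.
Qed.

Lemma recursive_env_least_below n B (P : (nat -> nat) -> pred nat) :
  recursive_env n B ->
  recursive_env n.+1 (fun v => P (fun i => v i.+1) (v 0)) ->
  recursive_env n (fun v => least_below (B v) (P v)).
Proof.
move=> rB rP.
have rL : recursive_env n.+1
    (fun v => least_below (v 0) (P (fun i => v i.+1))).
  apply: (@recursive_env_prim n (fun=> 0)
    (fun v => v 1 + ((v 1 == v 0) && ~~ P (fun i => v i.+2) (v 0)))) => //.
  - exact: recursive_env_const.
  - apply: (recursive_env_app2 computable2_addn).
      exact: recursive_env_var.
    apply: recursive_env_andb.
      by apply: (recursive_env_app2 computable2_eqn); exact: recursive_env_var.
    apply: recursive_env_negb.
    pose G i (v : nat -> nat) := if i is j.+1 then v j.+2 else v 0.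
    apply: (recursive_env_comp (G := G) rP) => [[|i] _|[|i] t //].
    + exact: recursive_env_var.
    + exact: recursive_env_var.
    + by move=> lt_ni; rewrite /G nth_default // size_tuple.
  - by move=> k v; rewrite least_belowS.
pose G i (v : nat -> nat) := if i is j.+1 then v j else B v.
apply: (recursive_env_comp (G := G) rL) => [[|i] _ //|[|i] t //].
  exact: recursive_env_var.
by move=> lt_ni; rewrite /G nth_default // size_tuple.
Qed.

Lemma recursive_env_exists_below n B (P : (nat -> nat) -> pred nat) :
  recursive_env n B ->
  recursive_env n.+1 (fun v => P (fun i => v i.+1) (v 0)) ->
  recursive_env n (fun v => exists_below (B v) (P v)).
Proof.
move=> rB rP.
apply: (@recursive_env_ext n (fun v => (least_below (B v) (P v)).+1 <= B v)).
  by move=> v; rewrite /exists_below has_find size_iota.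
exact: (recursive_env_app2 computable2_leq
  (recursive_env_app1 computable1_succ (recursive_env_least_below rB rP)) rB).
Qed.

Lemma recursive_env_forall_below n B (P : (nat -> nat) -> pred nat) :
  recursive_env n B ->
  recursive_env n.+1 (fun v => P (fun i => v i.+1) (v 0)) ->
  recursive_env n (fun v => forall_below (B v) (P v)).
Proof.
move=> rB rP.
apply: (@recursive_env_ext n
  (fun v => ~~ exists_below (B v) (fun k => ~~ P v k))) => [v|].
  by rewrite /exists_below -all_predC /forall_below; congr nat_of_bool;
     apply: eq_all => k /=; rewrite negbK.
exact/recursive_env_negb/recursive_env_exists_below/recursive_env_negb.
Qed.

Create HintDb computable discriminated.
#[local] Hint Resolve computable1_succ computable1_pred computable2_addn
  computable2_muln computable2_subn computable2_leq computable2_eqn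
  : computable.

Ltac solve_recursive_env :=
  lazymatch goal with
  | |- recursive_env _ (fun v => v ?i) => apply: recursive_env_var
  | |- recursive_env _ (fun _ => ?k) => apply: recursive_env_const
  | |- recursive_env ?n (fun v => nat_of_bool (~~ @?P v)) =>
      apply: (@recursive_env_negb n P); solve_recursive_env
  | |- recursive_env ?n (fun v => nat_of_bool (@?P v && @?Q v)) =>
      apply: (@recursive_env_andb n P Q); solve_recursive_env
  | |- recursive_env ?n (fun v => nat_of_bool (@?P v || @?Q v)) =>
      apply: (@recursive_env_orb n P Q); solve_recursive_env
  | |- recursive_env ?n (fun v => least_below (@?B v) (@?P v)) =>
      apply: (@recursive_env_least_below n B P); solve_recursive_env
  | |- recursive_env ?n
         (fun v => nat_of_bool (exists_below (@?B v) (@?P v))) =>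
      apply: (@recursive_env_exists_below n B P); solve_recursive_env
  | |- recursive_env ?n
         (fun v => nat_of_bool (forall_below (@?B v) (@?P v))) =>
      apply: (@recursive_env_forall_below n B P); solve_recursive_env
  | |- recursive_env ?n (fun v => nat_of_bool (?p (@?F1 v) (@?F2 v))) =>
      apply: (@recursive_env_app2 n (fun x y => nat_of_bool (p x y)) F1 F2);
      [auto with computable | solve_recursive_env | solve_recursive_env]
  | |- recursive_env ?n (fun v => nat_of_bool (?p (@?F v))) =>
      apply: (@recursive_env_app1 n (fun x => nat_of_bool (p x)) F);
      [auto with computable | solve_recursive_env]
  | |- recursive_env ?n (fun v => ?f (@?F1 v) (@?F2 v)) =>
      apply: (@recursive_env_app2 n f F1 F2);
      [auto with computable | solve_recursive_env | solve_recursive_env]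
  | |- recursive_env ?n (fun v => ?f (@?F v)) =>
      apply: (@recursive_env_app1 n f F);
      [auto with computable | solve_recursive_env]
  end.

Ltac computability :=
  lazymatch goal with
  | |- computable1 ?f =>
      change (recursive_env 1 (fun v => f (v 0))); cbv beta; solve_recursive_env
  | |- computable2 ?f =>
      change (recursive_env 2 (fun v => f (v 0) (v 1))); cbv beta;
      solve_recursive_env
  | |- computable3 ?f =>
      change (recursive_env 3 (fun v => f (v 0) (v 1) (v 2))); cbv beta;
      solve_recursive_env
  end.

Lemma computable2_divn : computable2 divn.
Proof.
rewrite (_ : divn =
  fun m d => (0 < d) * least_below m.+1 (fun q => m < q.+1 * d)).
  computability.
apply/funext => m; apply/funext => -[|d]; first by rewrite divn0.
rewrite mul1n; apply/esym/least_below_unique; first by rewrite ltnS leq_div.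
by move=> q _; rewrite -ltn_divLR // ltnS.
Qed.

Lemma computable2_expn : computable2 expn.
Proof.
have rexp : computable2 (fun n m => m ^ n).
  apply: (@recursive_env_prim 1 (fun=> 1) (fun v => v 2 * v 1)
    (fun v => v 1 ^ v 0)) => [| |v|k v].
  - exact: recursive_env_const.
  - solve_recursive_env.
  - exact: expn0.
  - exact: expnS.
exact: (recursive_env_app2 rexp (recursive_env_var 2 1)
                                (recursive_env_var 2 0)).
Qed.

#[local] Hint Resolve computable2_divn computable2_expn : computable.

Lemma computable1_odd : computable1 (fun n => odd n).
Proof.
rewrite (_ : (fun n => _) = fun n => n - n %/ 2 * 2) //; first by computability.
by apply/funext => n; rewrite -modn2 {2}(divn_eq n 2) addKn.
Qed.

#[local] Hint Resolve computable1_odd : computable.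

(** * Differences of c.e. sets *)

Definition changes (f : nat -> bool) (n : nat) : nat :=
  count (fun k => f k != f k.+1) (iota 0 n).

Lemma changesS f n : changes f n.+1 = changes f n + (f n != f n.+1).
Proof. by rewrite /changes -[in iota _ _]addn1 iotaD count_cat /= addn0. Qed.

Lemma leq_changes f : {homo changes f : m n / m <= n}.
Proof. by apply: homo_leq leq_trans _ => // n; rewrite changesS leq_addr. Qed.

Lemma odd_changes f n : odd (changes f n) = f 0 (+) f n.
Proof.
elim: n => [|n IHn]; first by rewrite addbb.
by rewrite changesS oddD IHn; case: (f 0) (f n) (f n.+1) => -[] [].
Qed.

Lemma card_le_natP T m (A : set T) :
  A #<= `I_m <->
  exists2 f : T -> nat, {in A &, injective f} & forall x, A x -> f x < m.
Proof.
split=> [/pcard_leP[f]|[f injf ltf]].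
  by exists f; [exact: inj | move=> x Ax; exact: (funS (s := f))].
rewrite -(card_le_eql (inj_card_eq injf)); apply: subset_card_le.
by move=> _ [x Ax <-]; exact: ltf.
Qed.

Lemma card_changes f m :
  [set k | f k <> f k.+1] #<= `I_m <-> forall n, changes f n <= m.
Proof.
split=> [/card_le_natP[g injg ltg] n|le_m].
  have chgP k : k \in [seq k <- iota 0 n | f k != f k.+1] -> f k <> f k.+1.
    by rewrite mem_filter => /andP[/eqP].
  rewrite /changes -size_filter -(size_iota 0 m) -(size_map g).
  apply: uniq_leq_size.
    rewrite map_inj_in_uniq ?filter_uniq ?iota_uniq // => k l /chgP ck /chgP cl.
    by apply: injg; rewrite inE.
  by move=> _ /mapP[k /chgP ck ->]; rewrite mem_iota; exact: ltg.
have lt_changes k : f k <> f k.+1 -> changes f k < changes f k.+1.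
  by move=> /eqP ck; rewrite changesS ck addn1.
apply/card_le_natP; exists (changes f) => [k l|k ck]; last first.
  exact: leq_trans (lt_changes _ ck) (le_m _).
rewrite !inE => /lt_changes ck /lt_changes cl e.
by case: (ltngtP k l) => // /(leq_changes f); lia.
Qed.

Lemma single_change (f : nat -> bool) : f 0 = false ->
  (exists k, f =1 ltn k) <-> exists! k, f k <> f k.+1.
Proof.
move=> f0; split=> [[k fE]|[k [ck uk]]].
  exists k; split=> [|l]; first by rewrite !fE /= ltnn ltnSn.
  by rewrite !fE /= ltnS; case: (ltngtP k l).
exists k => n; have := odd_changes f n; rewrite f0 /= => <-.
rewrite /changes (@eq_count _ _ (pred1 k)) => [|l /=].
  by rewrite count_uniq_mem ?iota_uniq // mem_iota /= oddb.
by apply/idP/eqP => [/eqP/uk|->] //; exact/eqP.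
Qed.

Section TwoChanges.
Variables (f : nat -> bool) (A : Prop).
Hypothesis f0 : f 0 = false.
Hypothesis limf : exists s0, forall s, s0 <= s -> (f s <-> A).
Hypothesis card2 : [set k | f k <> f k.+1] #<= `I_2.

(* A function that is true in the limit but falls back to false in between
   changes at least three times. *)
Lemma two_changes_limit : A <-> exists k, f =1 ltn k.
Proof.
have [s0 fA] := limf; have le2 := (card_changes f 2).1 card2.
split=> [tA|[k fE]]; last first.
  by apply/(fA (maxn s0 k.+1)); rewrite ?leq_maxl // fE /= leq_maxr.
have f_s0 : f s0 by exact/fA.
case: (ex_minnP (ex_intro _ s0 f_s0)) => -[|k]; first by rewrite f0.
move=> fk min_k; exists k => t /=; apply/idP/idP => [/min_k//|lt_kt].
apply: contraT => /negbTE ft; have f_max : f (maxn t s0).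
  by apply/fA => //; exact: leq_maxr.
have := leq_changes f lt_kt; have := leq_changes f (leq_maxl t s0).
have := le2 (maxn t s0).
have := odd_changes f k.+1; have := odd_changes f t.
have := odd_changes f (maxn t s0); rewrite f0 f_max ft fk /=.
move: (changes _ _) (changes _ _) (changes _ _) => a b c; lia.
Qed.

Lemma two_changes_rise_no_fall :
  A <-> (exists s, f s) /\ ~ exists t, ~~ f t && exists_below t f.
Proof.
split=> [/two_changes_limit[k fE]|].
  split; first by exists k.+1; rewrite fE /= ltnSn.
  move=> [t /andP[+ /exists_belowP[s lt_st]]].
  by rewrite !fE /= -leqNgt => le_tk lt_ks; lia.
move=> [[s fs] nofall]; have [s0 fA] := limf.
apply/(fA (maxn s.+1 s0)); first exact: leq_maxr.
apply: contraT => nf; case: nofall; exists (maxn s.+1 s0); rewrite nf.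
by apply/exists_belowP; exists s; rewrite ?leq_maxl.
Qed.

End TwoChanges.

Definition ce_difference (p q : nat -> nat -> bool) : set nat :=
  [set x | (exists t, p x t) /\ ~ exists t, q x t].

Lemma Sigma2inv_ce_difference (p q : nat -> nat -> bool) :
  computable2 (fun x t => p x t) -> computable2 (fun x t => q x t) ->
  Sigma2inv (ce_difference p q).
Proof.
move=> cp cq.
exists (fun x s => exists_below s (p x) && ~~ exists_below s (q x)); split=> //.
- computability.
- move=> x; have [[t qt]|nq] := EM (exists t, q x t).
    exists t.+1 => s lt_ts; split=> [/andP[_ /exists_belowP[]]|[_ []]].
      by exists t.
    by exists t.
  have [[t pt]|np] := EM (exists t, p x t); last first.
    exists 0 => s _; split=> [/andP[/exists_belowP[t _ pt] _]|[]//].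
    by case: np; exists t.
  exists t.+1 => s lt_ts; split=> [_|_]; first by split=> //; exists t.
  apply/andP; split; first by apply/exists_belowP; exists t.
  by apply/exists_belowP => -[u _ qu]; apply: nq; exists u.
- move=> x; apply/card_changes => n; set f := (f in changes f n).
  suff: changes f n <= exists_below n (p x) + exists_below n (q x).
    by case: exists_below (exists_below n (q x)) => -[]; lia.
  elim: n => // n IHn; rewrite changesS /f !exists_belowS.
  move: IHn; rewrite -/f; move: (changes f n) => c.
  by case: (exists_below n (p x)) (exists_below n (q x)) (p x n) (q x n)
    => -[] [] [] /=; lia.
Qed.

Lemma Sigma2inv_is_ce_difference (A : set nat) : Sigma2inv A ->
  exists p q : nat -> nat -> bool,
    [/\ computable2 (fun x t => p x t), computable2 (fun x t => q x t) &
        A = ce_difference p q].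
Proof.
move=> [f [cf f0 limf card2]].
exists f, (fun x t => ~~ f x t && exists_below t (f x)); split=> //.
  computability.
apply/seteqP; split=> x.
  by move/(two_changes_rise_no_fall (f0 x) (limf x) (card2 x)).
by move/(two_changes_rise_no_fall (f0 x) (limf x) (card2 x)).
Qed.

(** * A universal difference of c.e. sets *)

Definition npair (x y : nat) : nat := (x + y) * (x + y) + x.

Definition nsqrt (n : nat) : nat :=
  least_below n.+1 (fun s => n < s.+1 * s.+1).

Definition nfst (n : nat) : nat := n - nsqrt n * nsqrt n.

Definition nsnd (n : nat) : nat := nsqrt n - nfst n.

Lemma nsqrt_npair x y : nsqrt (npair x y) = x + y.
Proof. by apply: least_below_unique => [|s _]; rewrite /npair; nia. Qed.

Lemma nfst_npair x y : nfst (npair x y) = x.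
Proof. by rewrite /nfst nsqrt_npair addKn. Qed.

Lemma nsnd_npair x y : nsnd (npair x y) = y.
Proof. by rewrite /nsnd nsqrt_npair nfst_npair addKn. Qed.

Definition npairK := (nfst_npair, nsnd_npair).

Lemma leq_npairl x y : x <= npair x y. Proof. exact: leq_addl. Qed.

Lemma leq_npairr x y : y <= npair x y. Proof. rewrite /npair; nia. Qed.

Lemma computable2_npair : computable2 npair.
Proof. by rewrite /npair; computability. Qed.

Lemma computable1_nfst : computable1 nfst.
Proof. by rewrite /nfst /nsqrt; computability. Qed.

Lemma computable1_nsnd : computable1 nsnd.
Proof. by rewrite /nsnd /nfst /nsqrt; computability. Qed.

#[local] Hint Resolve computable2_npair computable1_nfst computable1_nsnd
  : computable.

(* Finite sets of natural numbers are coded by the binary digits of a number. *)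
Definition bit (D n : nat) : bool := odd (D %/ 2 ^ n).

Lemma computable2_bit : computable2 (fun D n => bit D n).
Proof. by rewrite /bit; computability. Qed.

#[local] Hint Resolve computable2_bit : computable.

Lemma bitS D n : bit D n.+1 = bit D./2 n.
Proof. by rewrite /bit expnS divnMA divn2. Qed.

Lemma bit_lt D n : bit D n -> n < D.
Proof.
rewrite /bit; case: (ltnP D (2 ^ n)) => [lt|le _]; first by rewrite divn_small.
exact: leq_trans (ltn_expl n _) le.
Qed.

Definition bits_sub (D E : nat) : Prop := forall n, bit D n -> bit E n.

Lemma bits_sub_leq D E : bits_sub D E -> D <= E.
Proof.
elim/ltn_ind: D E => -[//|D] IHD E sDE.
rewrite -(odd_double_half D.+1) -(odd_double_half E); apply: leq_add.
  have := sDE 0; rewrite /bit !divn1.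
  by case: (odd D.+1) (odd E) => -[] // /(_ isT).
rewrite leq_double; apply: IHD => [|n]; first by rewrite -divn2 ltn_Pdiv.
by rewrite -!bitS; exact: sDE.
Qed.

Lemma exists_bits_below N (p : pred nat) :
  exists D, forall n, bit D n = (n < N) && p n.
Proof.
elim: N p => [|N IHN] p; first by exists 0 => n; rewrite /bit div0n.
have [D HD] := IHN (fun n => p n.+1); exists (p 0 + D.*2) => -[|n].
  by rewrite /bit divn1 oddD odd_double addbF oddb.
by rewrite bitS half_bit_double HD.
Qed.

Lemma exists_bits_bounded N (p : pred nat) :
  (forall n, p n -> n < N) -> exists D, forall n, bit D n = p n.
Proof.
move=> ltN; have [D DE] := exists_bits_below N p; exists D => n.
by rewrite DE; case: (boolP (p n)) => [/ltN->|_]; rewrite ?andbF.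
Qed.

(* [fact c x y] codes the assertion that the program c maps x to y. *)
Definition fact (c x y : nat) : nat := npair c (npair x y).

Definition known (D c x y : nat) : bool := bit D (fact c x y).

Lemma known_lt D c x y : known D c x y -> y < D.
Proof.
move=> /bit_lt; apply: leq_ltn_trans.
exact: leq_trans (leq_npairr x y) (leq_npairr c _).
Qed.

Definition zero_code : nat := npair 0 0.
Definition succ_code : nat := npair 1 0.
Definition head_code : nat := npair 2 0.
Definition tail_code : nat := npair 3 0.
Definition cons_code (f g : nat) : nat := npair 4 (npair f g).
Definition comp_code (f g : nat) : nat := npair 5 (npair f g).
Definition prim_code (f g : nat) : nat := npair 6 (npair f g).
Definition mu_code (f : nat) : nat := npair 7 (npair f 0).

(* [fact c x y] follows in one step from the facts in D. *)
Definition entails (D c x y : nat) : bool :=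
  let tag := nfst c in let f := nfst (nsnd c) in let g := nsnd (nsnd c) in
  [|| (tag == 0) && (y == 0),
      (tag == 1) && (y == (nfst x).+1),
      (tag == 2) && (y == nfst x),
      (tag == 3) && (y == nsnd x),
      [&& tag == 4, y == npair (nfst y) (nsnd y), known D f x (nfst y) &
        known D g x (nsnd y)],
      (tag == 5) && exists_below D (fun z => known D g x z && known D f z y),
      [&& tag == 6, nfst x == 0 & known D f (nsnd x) y],
      [&& tag == 6, 0 < nfst x & exists_below D (fun z =>
        known D c (npair (nfst x).-1 (nsnd x)) z &&
        known D g (npair (nfst x).-1 (npair z (nsnd x))) y)] |
      [&& tag == 7, known D f (npair y x) 0 &
        forall_below y (fun k => exists_below D (fun z =>
          known D f (npair k x) z.+1))]].

Lemma entails_cons D f g x y : entails D (cons_code f g) x y =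
  [&& y == npair (nfst y) (nsnd y), known D f x (nfst y) &
      known D g x (nsnd y)].
Proof. by rewrite /entails !npairK /= orbF. Qed.

Lemma entails_comp D f g x y : entails D (comp_code f g) x y =
  exists_below D (fun z => known D g x z && known D f z y).
Proof. by rewrite /entails !npairK /= orbF. Qed.

Lemma entails_prim0 D f g v y :
  entails D (prim_code f g) (npair 0 v) y = known D f v y.
Proof. by rewrite /entails !npairK /= orbF. Qed.

Lemma entails_primS D f g k v y :
  entails D (prim_code f g) (npair k.+1 v) y =
  exists_below D (fun z => known D (prim_code f g) (npair k v) z &&
                           known D g (npair k (npair z v)) y).
Proof. by rewrite /entails !npairK /= orbF. Qed.

Lemma entails_mu D f x y : entails D (mu_code f) x y =
  known D f (npair y x) 0 &&
  forall_below y (fun k =>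
    exists_below D (fun z => known D f (npair k x) z.+1)).
Proof. by rewrite /entails !npairK. Qed.

Lemma entails_mono D E c x y :
  bits_sub D E -> entails D c x y -> entails E c x y.
Proof.
move=> sDE; have known_mono c' x' y' : known D c' x' y' -> known E c' x' y'.
  exact: sDE.
have exists_mono (p q : pred nat) :
    (forall z, p z -> q z) -> exists_below D p -> exists_below E q.
  move=> pq /exists_belowP[z ltz pz]; apply/exists_belowP; exists z.
    exact: leq_trans ltz (bits_sub_leq sDE).
  exact: pq.
have orb_mono (a a' b b' : bool) : (a -> a') -> (b -> b') -> a || b -> a' || b'.
  by move=> aa' bb' /orP[/aa'->|/bb'->] //; rewrite orbT.
rewrite /entails; do 4![apply: (orb_mono) => //].
apply: (orb_mono) => [/and4P[-> -> /known_mono-> /known_mono->]//|].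
apply: (orb_mono) => [/andP[-> /=]|].
  by apply: (exists_mono) => z /andP[/known_mono-> /known_mono->].
apply: (orb_mono) => [/and3P[-> -> /known_mono]//|].
apply: (orb_mono) => [/and3P[-> -> /=]|/and3P[-> /known_mono-> /=]].
  by apply: (exists_mono) => z /andP[/known_mono-> /known_mono->].
move=> /forall_belowP ex; apply/forall_belowP => k /ex.
by apply: (exists_mono) => z /known_mono.
Qed.

Definition justified (D n : nat) : bool :=
  entails D (nfst n) (nfst (nsnd n)) (nsnd (nsnd n)).

(* No well-foundedness is required: a fact about a total program can only be
   justified, directly or not, by correct facts. *)
Definition valid (D : nat) : bool :=
  forall_below D (fun n => ~~ bit D n || justified D n).

Lemma computable1_valid : computable1 (fun D => valid D).
Proof.
by rewrite /valid /justified /entails /known /fact; computability.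
Qed.

Lemma validP D : reflect (forall n, bit D n -> justified D n) (valid D).
Proof.
apply: (iffP (forall_belowP _ _)) => vD n.
  by move=> Dn; have := vD n (bit_lt Dn); rewrite Dn.
by case: (boolP (bit D n)) => // /vD.
Qed.

Lemma valid_entails D c x y : valid D -> known D c x y -> entails D c x y.
Proof. by move=> /validP vD /vD; rewrite /justified !npairK. Qed.

Lemma valid_supported E :
  (forall n, bit E n -> exists2 D, bits_sub D E & justified D n) -> valid E.
Proof. by move=> sE; apply/validP => n /sE[D /entails_mono]; exact. Qed.

Lemma valid_union D E : valid D -> valid E ->
  exists2 U, valid U & bits_sub D U /\ bits_sub E U.
Proof.
move=> /validP vD /validP vE.
have [|U UE] := @exists_bits_bounded (D + E) (fun n => bit D n || bit E n).
  by move=> n /orP[] /bit_lt; lia.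
have sDU : bits_sub D U by move=> n Dn; rewrite UE Dn.
have sEU : bits_sub E U by move=> n En; rewrite UE En orbT.
exists U => //; apply: valid_supported => n; rewrite UE => /orP[Dn|En].
  by exists D => //; exact: vD.
by exists E => //; exact: vE.
Qed.

Definition derivable (c x y : nat) : Prop :=
  exists2 D, valid D & known D c x y.

Lemma derivable_entails D c x y : valid D -> entails D c x y -> derivable c x y.
Proof.
move=> /validP vD Dcxy.
have [|U UE] := @exists_bits_bounded (D + fact c x y).+1
  (fun n => bit D n || (n == fact c x y)).
  by move=> n /orP[/bit_lt|/eqP->]; lia.
exists U; last by rewrite /known UE eqxx orbT.
apply: valid_supported => n; rewrite UE => nU.
exists D => [m Dm|]; first by rewrite UE Dm.
by case/orP: nU => [/vD//|/eqP->]; rewrite /justified !npairK.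
Qed.

Lemma derivable_common c x y c' x' y' : derivable c x y -> derivable c' x' y' ->
  exists2 D, valid D & known D c x y /\ known D c' x' y'.
Proof.
move=> [D vD Dy] [E vE Ey]; have [U vU [sDU sEU]] := valid_union vD vE.
by exists U => //; split; [exact: sDU | exact: sEU].
Qed.

Definition computes (c x y : nat) : Prop :=
  derivable c x y /\ forall D y', valid D -> known D c x y' -> y' = y.

Lemma computes_intro c x y :
  (exists2 D, valid D & entails D c x y) ->
  (forall D y', valid D -> entails D c x y' -> y' = y) -> computes c x y.
Proof.
move=> [D vD Dy] uy; split; first exact: derivable_entails Dy.
by move=> E y' vE /(valid_entails vE); exact: uy.
Qed.

Lemma computes_axiom c x y :
  (forall D y', entails D c x y' = (y' == y)) -> computes c x y.
Proof.
move=> cE; apply: computes_intro => [|D y' _]; last by rewrite cE => /eqP.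
by exists 0; rewrite ?cE.
Qed.

Lemma computes_zero x : computes zero_code x 0.
Proof.
by apply: computes_axiom => D y; rewrite /entails !npairK /= orbF.
Qed.

Lemma computes_succ a l : computes succ_code (npair a l) a.+1.
Proof.
by apply: computes_axiom => D y; rewrite /entails !npairK /= orbF.
Qed.

Lemma computes_head a l : computes head_code (npair a l) a.
Proof.
by apply: computes_axiom => D y; rewrite /entails !npairK /= orbF.
Qed.

Lemma computes_tail a l : computes tail_code (npair a l) l.
Proof.
by apply: computes_axiom => D y; rewrite /entails !npairK /= orbF.
Qed.

Lemma computes_cons f g x y1 y2 : computes f x y1 -> computes g x y2 ->
  computes (cons_code f g) x (npair y1 y2).
Proof.
move=> [df uf] [dg ug]; apply: computes_intro => [|D y vD].
  have [D vD [Df Dg]] := derivable_common df dg; exists D => //.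
  by rewrite entails_cons !npairK eqxx Df.
rewrite entails_cons => /and3P[/eqP-> /(uf _ _ vD)<- /(ug _ _ vD)<-].
by rewrite !npairK.
Qed.

Lemma computes_comp f g x z y : computes g x z -> computes f z y ->
  computes (comp_code f g) x y.
Proof.
move=> [dg ug] [df uf]; apply: computes_intro => [|D y' vD].
  have [D vD [Dg Df]] := derivable_common dg df; exists D => //.
  rewrite entails_comp; apply/exists_belowP.
  by exists z; [exact: known_lt Dg | rewrite Dg].
rewrite entails_comp => /exists_belowP[z' _ /andP[/(ug _ _ vD)->]].
exact: uf.
Qed.

Lemma computes_prim0 f g v y :
  computes f v y -> computes (prim_code f g) (npair 0 v) y.
Proof.
move=> [[D vD Df] uf]; apply: computes_intro => [|E y' vE].
  by exists D; rewrite ?entails_prim0.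
by rewrite entails_prim0; exact: uf.
Qed.

Lemma computes_primS f g k v z y : computes (prim_code f g) (npair k v) z ->
  computes g (npair k (npair z v)) y ->
  computes (prim_code f g) (npair k.+1 v) y.
Proof.
move=> [dk uk] [dg ug]; apply: computes_intro => [|D y' vD].
  have [D vD [Dk Dg]] := derivable_common dk dg; exists D => //.
  rewrite entails_primS; apply/exists_belowP.
  by exists z; [exact: known_lt Dk | rewrite Dk].
rewrite entails_primS => /exists_belowP[z' _ /andP[/(uk _ _ vD)->]].
exact: ug.
Qed.

Lemma derivable_family f (a F : nat -> nat) n :
  (forall k, derivable f (a k) (F k)) ->
  exists2 D, valid D & forall k, k < n -> known D f (a k) (F k).
Proof.
move=> dF; elim: n => [|n [D vD Dn]]; first by exists 0.
have [E vE En] := dF n; have [U vU [sDU sEU]] := valid_union vD vE.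
exists U => // k; rewrite ltnS leq_eqVlt => /predU1P[->|/Dn]; last exact: sDU.
exact: sEU.
Qed.

Lemma computes_mu f (F : nat -> nat) x y :
  (forall k, computes f (npair k x) (F k)) -> F y = 0 ->
  (forall k, k < y -> F k <> 0) -> computes (mu_code f) x y.
Proof.
move=> cF Fy0 F_pos; apply: computes_intro => [|D y' vD].
  have [D vD Dk] := derivable_family y.+1 (fun k => (cF k).1).
  exists D; rewrite // entails_mu -{1}Fy0 Dk //=.
  apply/forall_belowP => k lt_ky; apply/exists_belowP; exists (F k).-1.
    apply: leq_ltn_trans (leq_pred _) _.
    exact: known_lt (Dk k (ltnW lt_ky)).
  have /eqP := F_pos k lt_ky; rewrite -lt0n => /prednK->.
  by apply: Dk; exact: ltnW.
rewrite entails_mu => /andP[/((cF _).2 _ _ vD) F0 /forall_belowP F'].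
case: (ltngtP y' y) => // [/F_pos|]; first by rewrite -F0.
by move=> /F' /exists_belowP[z _ /((cF _).2 _ _ vD)]; rewrite Fy0.
Qed.

Fixpoint encode (s : seq nat) : nat :=
  if s is x :: s' then npair x (encode s') else 0.

Definition implements n (c : nat) (F : n.-tuple nat -> nat) : Prop :=
  forall v : n.-tuple nat, computes c (encode v) (F v).

Lemma computes_nth i : exists c, forall s, i < size s ->
  computes c (encode s) (nth 0 s i).
Proof.
elim: i => [|i [c cP]].
  by exists head_code => -[|x s] //= _; exact: computes_head.
exists (comp_code c tail_code) => -[|x s] //= lt_is.
exact: computes_comp (computes_tail _ _) (cP _ lt_is).
Qed.

Lemma implements_encode_map n (I : Type) (g : I -> n.-tuple nat -> nat)
    (s : seq I) :
  (forall i, exists c, implements c (g i)) ->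
  exists c, implements c (fun v => encode [seq g i v | i <- s]).
Proof.
move=> cg; elim: s => [|i s [c cP]].
  by exists zero_code => v; exact: computes_zero.
have [ci ciP] := cg i; exists (cons_code ci c) => v.
exact: computes_cons.
Qed.

Lemma recursive_implements n (F : n.-tuple nat -> nat) :
  recursive F -> exists c, implements c F.
Proof.
elim=> {n F}.
- by move=> n; exists zero_code => v; exact: computes_zero.
- exists succ_code => -[[|x []] // sz] /=.
  by rewrite /thead (tnth_nth 0); exact: computes_succ.
- move=> n i; have [c cP] := computes_nth i.
  by exists c => v; rewrite (tnth_nth 0); apply: cP; rewrite size_tuple.
- move=> m n f g _ [cf cfP] _ cg.
  have [c cP] := implements_encode_map (enum 'I_m) cg.
  exists (comp_code cf c) => v.
  apply: computes_comp (cP v) _; exact: (cfP [tuple g i v | i < m]).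
- move=> n f g h _ [cf cfP] _ [cg cgP] h0 hS.
  exists (prim_code cf cg) => v; rewrite (tuple_eta v) /=.
  elim: (thead v) => [|k IHk]; first by rewrite h0; exact: computes_prim0.
  by rewrite hS; apply: computes_primS IHk _; exact: cgP [tuple of _ :: _ :: _].
- move=> n f h _ [cf cfP] h0 h_lt; exists (mu_code cf) => v.
  apply: (computes_mu (F := fun k => f [tuple of k :: v])) => // k.
    exact: cfP [tuple of _ :: _].
  exact: h_lt.
- by move=> n f g fg _ [c cP]; exists c => v; rewrite -fg.
Qed.

#[local] Hint Resolve computable1_valid : computable.

Definition accepts (c x t : nat) : bool :=
  valid t && exists_below t (fun s => known t c (encode [:: x; s]) 1).

Lemma accepts_universal (p : nat -> nat -> bool) :
  computable2 (fun x s => p x s) ->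
  exists c, forall x, (exists s, p x s) <-> exists t, accepts c x t.
Proof.
move=> /recursive_implements[c cP]; exists c => x.
have {}cP s : computes c (encode [:: x; s]) (p x s) by exact: cP [tuple x; s].
split=> [[s ps]|[t /andP[vt /exists_belowP[s _ t_xs]]]]; last first.
  by exists s; have := (cP s).2 _ _ vt t_xs; case: (p x s).
have [t vt] := (cP s).1; rewrite ps => t_xs; exists t; rewrite /accepts vt.
apply/exists_belowP; exists s => //.
have : encode [:: x; s] < t.
  move/bit_lt: t_xs; apply: leq_ltn_trans.
  exact: leq_trans (leq_npairl _ 1) (leq_npairr c _).
apply: leq_ltn_trans.
exact: leq_trans (leq_npairl s 0) (leq_npairr x _).
Qed.

Definition universal_ce_difference : set nat :=
  ce_difference (fun n => accepts (nfst (nfst n)) (nsnd n))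
                (fun n => accepts (nsnd (nfst n)) (nsnd n)).

Lemma Sigma2inv_complete_universal : Sigma2inv_complete universal_ce_difference.
Proof.
split=> [|A /Sigma2inv_is_ce_difference[p [q [cp cq ->]]]].
  by apply: Sigma2inv_ce_difference; rewrite /accepts /known /fact /=;
    computability.
have [a aP] := accepts_universal cp; have [b bP] := accepts_universal cq.
exists (npair (npair a b)); first by computability.
by move=> x; rewrite /universal_ce_difference /ce_difference /= !npairK aP bP.
Qed.

(** * Walks and trails *)

Definition incidence (u : nat) (e : edge) : nat := (e.1.1 == u) + (e.1.2 == u).

Definition opposite (e : edge) (u : nat) : nat :=
  if e.1.1 == u then e.1.2 else e.1.1.

Lemma incidence_gt0P u e : reflect (e.1.1 = u \/ e.1.2 = u) (0 < incidence u e).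
Proof.
rewrite /incidence addn_gt0 !lt0b.
by apply: (iffP orP) => -[/eqP|/eqP]; [left|right|left|right].
Qed.

Lemma incidence_end1 (e : edge) : 0 < incidence e.1.1 e.
Proof. by apply/incidence_gt0P; left. Qed.

Lemma incidence_end2 (e : edge) : 0 < incidence e.1.2 e.
Proof. by apply/incidence_gt0P; right. Qed.

Lemma joinsP e u v :
  joins e u v <-> 0 < incidence u e /\ opposite e u = v.
Proof.
case: e => -[x y] i; rewrite /joins /opposite /=; split=> [|[]].
  by case=> -[-> ->]; rewrite /incidence /= eqxx ?addn1 //; case: eqP => [->|].
move/incidence_gt0P => /= [->|->]; first by rewrite eqxx => <-; left.
by case: eqP => [->|_] <-; auto.
Qed.

Lemma joins_opposite e u : 0 < incidence u e -> joins e u (opposite e u).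
Proof. by move=> eu; apply/joinsP. Qed.

Lemma incident_cases e u w :
  0 < incidence u e -> 0 < incidence w e -> w = u \/ w = opposite e u.
Proof.
by move=> /joins_opposite[] e1 /incidence_gt0P; rewrite e1 /= => -[] <-; auto.
Qed.

Lemma odd_incidence a e u : 0 < incidence a e ->
  odd (incidence u e) = (u == a) (+) (u == opposite e a).
Proof.
move=> /joins_opposite; set b := opposite e a.
by rewrite /incidence oddD !oddb !(eq_sym u) => -[] -> //=; rewrite addbC.
Qed.

Definition degree_in (L : seq edge) (u : nat) : nat :=
  \sum_(e <- L) incidence u e.

Lemma degree_in_cat L1 L2 u :
  degree_in (L1 ++ L2) u = degree_in L1 u + degree_in L2 u.
Proof. exact: big_cat. Qed.

Lemma perm_degree_in L1 L2 u : perm_eq L1 L2 -> degree_in L1 u = degree_in L2 u.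
Proof. exact: perm_big. Qed.

Lemma degree_in_gt0 L u :
  0 < degree_in L u -> exists2 e, e \in L & 0 < incidence u e.
Proof.
rewrite /degree_in lt0n sum_nat_seq_neq0 => /hasP[e eL /=].
by rewrite -lt0n => eu; exists e.
Qed.

Lemma eq_degree_in L1 L2 u : uniq L1 -> uniq L2 ->
  (forall e, 0 < incidence u e -> (e \in L1) = (e \in L2)) ->
  degree_in L1 u = degree_in L2 u.
Proof.
move=> uL1 uL2 L12.
have degree_filter L :
    degree_in L u = degree_in [seq e <- L | 0 < incidence u e] u.
  rewrite /degree_in big_filter [LHS](bigID (fun e => 0 < incidence u e)) /=.
  by rewrite [X in _ + X]big1 ?addn0 // => e; rewrite -eqn0Ngt => /eqP.
rewrite degree_filter [RHS]degree_filter.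
apply/perm_degree_in/uniq_perm; rewrite ?filter_uniq // => e.
by rewrite !mem_filter; case: (ltnP 0 (incidence u e)) => // /L12.
Qed.

Lemma sum_eq_uniq (s : seq nat) v :
  uniq s -> v \in s -> \sum_(u <- s) (v == u) = 1.
Proof.
move=> us vs; rewrite (bigD1_seq v) //= eqxx big1 // => u.
by rewrite eq_sym => /negbTE->.
Qed.

Lemma handshake (L : seq edge) (us : seq nat) : uniq us ->
  (forall e, e \in L -> e.1.1 \in us /\ e.1.2 \in us) ->
  \sum_(u <- us) degree_in L u = (size L).*2.
Proof.
move=> uus Lus; rewrite exchange_big /= big_seq (eq_bigr (fun=> 2)) => [|e eL].
  by rewrite -big_seq big_const_seq count_predT iter_addn_0 mul2n.
by have [e1 e2] := Lus e eL; rewrite big_split /= !sum_eq_uniq.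
Qed.

Fixpoint walk (a : nat) (T : seq edge) : bool :=
  if T is e :: T' then (0 < incidence a e) && walk (opposite e a) T' else true.

Definition walk_end (a : nat) (T : seq edge) : nat :=
  foldl (fun u e => opposite e u) a T.

Lemma walk_cat a T1 T2 :
  walk a (T1 ++ T2) = walk a T1 && walk (walk_end a T1) T2.
Proof. by elim: T1 a => //= e T1 IHT a; rewrite IHT andbA. Qed.

Lemma walk_end_cat a T1 T2 :
  walk_end a (T1 ++ T2) = walk_end (walk_end a T1) T2.
Proof. exact: foldl_cat. Qed.

Lemma odd_degree_walk u a T :
  walk a T -> odd (degree_in T u) = (u == a) (+) (u == walk_end a T).
Proof.
elim: T a => [|e T IHT] a /=; first by rewrite /degree_in big_nil addbb.
case/andP=> ea wT; rewrite /degree_in big_cons oddD (odd_incidence u ea).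
rewrite -/(degree_in T u) (IHT _ wT) -addbA; congr (_ (+) _).
by rewrite addbA addbb.
Qed.

Definition visits (a : nat) (T : seq edge) (u : nat) : Prop :=
  exists T1 T2, T = T1 ++ T2 /\ walk_end a T1 = u.

Lemma visits_start a T : visits a T a.
Proof. by exists [::], T. Qed.

Lemma walk_visits a T e u :
  walk a T -> e \in T -> 0 < incidence u e -> visits a T u.
Proof.
move=> + eT; case/path.splitPr: eT => T1 T2.
rewrite walk_cat => /andP[_ /= /andP[ea _]] /(incident_cases ea)[] ->.
  by exists T1, (e :: T2).
by exists (rcons T1 e), T2; rewrite cat_rcons -cats1 walk_end_cat.
Qed.

Definition trail (E : set edge) (a : nat) (T : seq edge) : Prop :=
  [/\ uniq T, forall e, e \in T -> E e & walk a T].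

Lemma sub_trail E E' a T : E `<=` E' -> trail E a T -> trail E' a T.
Proof. by move=> sEE' [uT TE wT]; split=> // e /TE /sEE'. Qed.

Lemma trail_cat E a T P : trail E a (T ++ P) <->
  trail E a T /\ trail (E `\` [set` T]) (walk_end a T) P.
Proof.
rewrite /trail cat_uniq walk_cat; split.
  move=> [/and3P[uT /hasPn TP uP] TPE /andP[wT wP]]; do 2![split=> //].
    by move=> e eT; apply: TPE; rewrite mem_cat eT.
  by move=> e eP; split; [apply: TPE; rewrite mem_cat eP orbT|exact/negP/TP].
move=> [[uT TE wT] [uP PE wP]]; split; last exact/andP.
  by rewrite uT uP andbT; apply/hasPn => e /PE[_ /negP].
by move=> e; rewrite mem_cat => /orP[/TE|/PE[]].
Qed.

Lemma trail_rcons E a T e : trail E a T -> E e -> e \notin T ->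
  0 < incidence (walk_end a T) e -> trail E a (rcons T e).
Proof.
move=> tT Ee eT ea; rewrite -cats1; apply/trail_cat; split=> //.
split; rewrite //= ?ea // => f; rewrite inE => /eqP->.
by split=> //; exact/negP.
Qed.

Lemma trail_splice E a T1 T2 C : trail E a (T1 ++ T2) ->
  trail (E `\` [set` T1 ++ T2]) (walk_end a T1) C ->
  walk_end (walk_end a T1) C = walk_end a T1 ->
  trail E a (T1 ++ C ++ T2) /\
  walk_end a (T1 ++ C ++ T2) = walk_end a (T1 ++ T2).
Proof.
move=> [uT TE wT] [uC CE wC] endC; rewrite !walk_end_cat endC; split=> //.
have perT : perm_eq (T1 ++ C ++ T2) ((T1 ++ T2) ++ C).
  by rewrite -catA perm_cat2l perm_catC.
split.
- rewrite (perm_uniq perT) cat_uniq uT uC andbT.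
  by apply/hasPn => e /CE[_ /negP].
- by move=> e; rewrite (perm_mem perT) mem_cat => /orP[/TE|/CE[]].
- by move: wT; rewrite !walk_cat endC => /andP[-> ->]; rewrite wC.
Qed.

(** * Reachability *)

Definition reach (E : set edge) (u : nat) : set nat :=
  [set v | clos_refl_trans nat (fun x y => exists2 e, E e & joins e x y) u v].

Lemma reach_refl E u : reach E u u.
Proof. exact: rt_refl. Qed.

Lemma reach_closed E (X : nat -> Prop) u v :
  (forall e, E e -> (X e.1.1 <-> X e.1.2)) -> reach E u v -> (X u <-> X v).
Proof.
move=> XE; elim=> {u v} [u v [e Ee]|//|u v w _ -> _ -> //].
by move: (XE e Ee) => XEe -[] ee; rewrite ee in XEe; case: XEe.
Qed.

Lemma reach_edge E u e : E e -> (reach E u e.1.1 <-> reach E u e.1.2).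
Proof.
by move=> Ee; split=> ru; apply: rt_trans ru _; apply: rt_step;
  exists e => //; [left|right]; case: e.1.
Qed.

Lemma reach_incident E u e v :
  E e -> 0 < incidence v e -> (reach E u v <-> reach E u e.1.1).
Proof. by move=> /(reach_edge u)[] ? ? /incidence_gt0P[] <-; split. Qed.

Lemma reach_trans E u v w : reach E u v -> reach E v w -> reach E u w.
Proof. exact: rt_trans. Qed.

Lemma reach_sym E u v : reach E u v -> reach E v u.
Proof.
by move=> uv; apply/(reach_closed (@reach_edge E v) uv); exact: reach_refl.
Qed.

Lemma reach_eq E u v : reach E u v -> reach E u = reach E v.
Proof.
move=> uv; apply/seteqP; split=> w; first exact: reach_trans (reach_sym uv).
exact: reach_trans uv.
Qed.

Lemma component_reach G F u : component G F u = reach (edges G `\` F) u.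
Proof.
rewrite /component /reach (_ : adjacent_off G F =
  fun x y => exists2 e, (edges G `\` F) e & joins e x y) //.
apply/funext => x; apply/funext => y; apply/propext; split.
  by move=> [e [eG eF exy]]; exists e.
by move=> [e [eG eF] exy]; exists e.
Qed.

Lemma walk_reach E a T : (forall e, e \in T -> E e) -> walk a T ->
  reach E a (walk_end a T).
Proof.
elim: T a => [|e T IHT] a TE; first by move=> _; exact: reach_refl.
move=> /= /andP[ea wT]; apply: (@reach_trans _ _ (opposite e a)).
  apply: rt_step; exists e; last exact: joins_opposite.
  by apply: TE; exact: mem_head.
by apply: IHT wT => f fT; apply: TE; rewrite inE fT orbT.
Qed.

Lemma visits_reach E a T u : trail E a T -> visits a T u -> reach E a u.
Proof.
move=> tT [T1 [T2 [eT <-]]]; move: tT; rewrite eT => /trail_cat[[_ T1E wT1] _].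
exact: walk_reach.
Qed.

Lemma reach_trail E a u :
  reach E a u -> exists2 T, trail E a T & walk_end a T = u.
Proof.
pose X v := exists2 T, trail E a T & walk_end a T = v.
have X_edge e v w : E e -> 0 < incidence v e -> 0 < incidence w e -> X v -> X w.
  move=> Ee ev ew [T tT eT]; have [eT'|eT'] := boolP (e \in T).
    have [_ _ wT] := tT; have [T1 [T2 [eT12 <-]]] := walk_visits wT eT' ew.
    by exists T1 => //; move: tT; rewrite eT12 => /trail_cat[].
  have [->|->] := incident_cases ev ew; first by exists T.
  exists (rcons T e); last by rewrite -cats1 walk_end_cat eT.
  by apply: trail_rcons; rewrite ?eT.
move=> /(reach_closed (X := X))[|Xa _]; last by apply: Xa; exists [::].
move=> e Ee; have [e1 e2] := (incidence_end1 e, incidence_end2 e).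
by split; exact: (X_edge e).
Qed.

Definition connected_from (E : set edge) (a : nat) : Prop :=
  forall e, E e -> reach E a e.1.1.

Lemma trail_through E a e : connected_from E a -> E e ->
  exists2 T, trail E a T & e \in T.
Proof.
move=> cE Ee; have [T tT eT] := reach_trail (cE e Ee).
have [eT'|eT'] := boolP (e \in T); first by exists T.
exists (rcons T e); last by rewrite mem_rcons mem_head.
by apply: trail_rcons => //; rewrite eT incidence_end1.
Qed.

(** * Finite Eulerian graphs *)

(* If [a = b], all degrees are even. *)
Definition odd_exactly_at_ends (H : seq edge) (a b : nat) : Prop :=
  forall u, odd (degree_in H u) = (u == a) (+) (u == b).

Lemma trail_size (H : seq edge) a T : trail [set` H] a T -> size T <= size H.
Proof. by move=> [uT TH _]; exact: uniq_leq_size. Qed.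

Lemma degree_in_rest (H T : seq edge) u : uniq H -> uniq T -> {subset T <= H} ->
  degree_in H u = degree_in T u + degree_in [seq e <- H | e \notin T] u.
Proof.
move=> uH uT sTH; rewrite -degree_in_cat; apply/perm_degree_in/uniq_perm => //.
  rewrite cat_uniq uT filter_uniq // andbT.
  by apply/hasPn => e; rewrite mem_filter => /andP[].
by move=> e; rewrite mem_cat mem_filter; case: (boolP (e \in T)) => // /sTH.
Qed.

Lemma trail_to_odd_end (H : seq edge) a b T :
  uniq H -> odd_exactly_at_ends H a b -> trail [set` H] a T ->
  exists2 Q, trail [set` H] a (T ++ Q) & walk_end a (T ++ Q) = b.
Proof.
move=> uH oddH; have [n] := ubnP (size H - size T).
elim: n T => // n IHn T le_n tT; have [eTb|eTb] := eqVneq (walk_end a T) b.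
  by exists [::]; rewrite cats0.
have [uT TH wT] := tT.
have [e] : exists2 e, e \in [seq e <- H | e \notin T] &
    0 < incidence (walk_end a T) e.
  apply/degree_in_gt0/odd_gt0; have := oddH (walk_end a T).
  rewrite (degree_in_rest _ uH uT TH) oddD (odd_degree_walk _ wT) eqxx.
  by rewrite (negbTE eTb) addbT addbF; case: (_ == a) (odd _) => -[].
rewrite mem_filter => /andP[eT eH] ea.
have tTe := trail_rcons tT eH eT ea.
have [|Q tQ eQ] := IHn _ _ tTe.
  by have := trail_size tTe; move: le_n; rewrite size_rcons; clear; lia.
by exists (e :: Q); rewrite -cat_rcons.
Qed.

(* A trail missing some edge misses one at a vertex it visits; there it can be
   interrupted by a closed trail, since the missing edges have even degrees. *)
Lemma trail_lengthen (H : seq edge) a b T e0 :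
  uniq H -> odd_exactly_at_ends H a b -> connected_from [set` H] a ->
  trail [set` H] a T -> walk_end a T = b ->
  e0 \in H -> e0 \notin T ->
  exists T', [/\ trail [set` H] a T', walk_end a T' = b & size T < size T'].
Proof.
move=> uH oddH cH tT eTb e0H e0T; have [uT TH wT] := tT.
have [u [e [[T1 [T2 [eT12 eT1]]] eH eT eu]]] : exists u e,
    [/\ visits a T u, e \in H, e \notin T & 0 < incidence u e].
  apply: contrapT => none; have inT e u :
      e \in H -> 0 < incidence u e -> visits a T u -> e \in T.
    by move=> eH eu vu; apply: contraT => eT; case: none; exists u, e.
  have visitsE e : e \in H -> (visits a T e.1.1 <-> visits a T e.1.2).
    move=> eH; have [e1 e2] := (incidence_end1 e, incidence_end2 e).
    by split=> ve; [exact: walk_visits (inT _ _ eH e1 ve) e2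
                   |exact: walk_visits (inT _ _ eH e2 ve) e1].
  have /(reach_closed visitsE)[v0 _] := cH e0 e0H.
  by case/negP: e0T; exact: inT e0H (incidence_end1 e0) (v0 (visits_start a T)).
pose R := [seq f <- H | f \notin T].
have RE : [set` R] `<=` [set` H] `\` [set` T].
  by move=> f /=; rewrite mem_filter => /andP[/negP].
have oddR : odd_exactly_at_ends R u u.
  move=> v; have := oddH v; rewrite (degree_in_rest _ uH uT TH) oddD.
  rewrite (odd_degree_walk _ wT) eTb -/R addbb.
  by case: (v == a) (v == b) (odd _) => -[] [].
have tRe : trail [set` R] u [:: e].
  split; rewrite //= ?eu // => f; rewrite inE => /eqP->.
  by rewrite /= mem_filter eT.
have [Q tQ eQ] := trail_to_odd_end (filter_uniq _ uH) oddR tRe.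
subst u T b; have [tT' eT'] := trail_splice tT (sub_trail RE tQ) eQ.
exists (T1 ++ ([:: e] ++ Q) ++ T2); split=> //.
by rewrite !size_cat /=; lia.
Qed.

Lemma euler_trail (H : seq edge) a b : uniq H -> odd_exactly_at_ends H a b ->
  connected_from [set` H] a ->
  exists T, [/\ perm_eq T H, walk a T & walk_end a T = b].
Proof.
move=> uH oddH cH.
have [|T0 tT0 eT0] := trail_to_odd_end (T := [::]) uH oddH; first by split.
have [n] := ubnP (size H - size ([::] ++ T0)); move: ([::] ++ T0) tT0 eT0.
elim: n => // n IHn T tT eTb le_n; have [uT TH wT] := tT.
have [sHT|/allPn[e eH eT]] := boolP (all [in T] H).
  exists T; split=> //; apply: uniq_perm => // e.
  by apply/idP/idP => [/TH|/(allP sHT)].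
have [T' [tT' eT' lt_TT']] := trail_lengthen uH oddH cH tT eTb eH eT.
by apply: (IHn T') => //; have := trail_size tT'; move: le_n lt_TT'; clear; lia.
Qed.

(** * Degrees in multigraphs *)

Lemma edge_vert G u e : edges G e -> 0 < incidence u e -> vert G u.
Proof.
move=> [_ /(leq_ltn_trans (leq0n _)) m_gt0] /incidence_gt0P[] <-.
  exact: mult_vert m_gt0.
by rewrite mult_sym in m_gt0; exact: mult_vert m_gt0.
Qed.

Definition star (G : multigraph) (u : nat) : set edge :=
  [set e | edges G e /\ 0 < incidence u e].

Definition incident_edges (G : multigraph) (u N : nat) : seq edge :=
  [seq (minn u w, maxn u w, i) | w <- iota 0 N, i <- iota 0 (mult G u w)].

Lemma uniq_incident_edges G u N : uniq (incident_edges G u N).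
Proof.
apply: allpairs_uniq_dep => [|w _|]; rewrite ?iota_uniq //.
by case=> [w i] [w' i'] _ _ /= [emin emax ->]; congr existT; lia.
Qed.

Lemma mem_incident_edges G u N e : (forall w, N <= w -> mult G u w = 0) ->
  (e \in incident_edges G u N) <-> star G u e.
Proof.
move=> far0; split=> [/allpairsPdep[w [i [_]]]|].
  rewrite mem_iota => /= lt_i ->; split; last first.
    by apply/incidence_gt0P => /=; lia.
  split=> /=; first by lia.
  by rewrite /minn /maxn; case: ifP => _ //; rewrite mult_sym.
case: e => -[x y] i [[/= le_xy lt_i] eu].
have [w xyE multE] : exists2 w, (x, y) = (minn u w, maxn u w) &
    mult G x y = mult G u w.
  case/incidence_gt0P: eu => /= <-; first by exists y => //; congr pair; lia.
  by exists x; [congr pair; lia | rewrite mult_sym].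
apply/allpairsPdep; exists w, i; rewrite !mem_iota /= -multE; split=> //.
  by rewrite ltnNge; apply/negP => /far0 m0; rewrite multE m0 in lt_i.
by rewrite -xyE.
Qed.

Lemma degree_incident_edges G u N : (forall w, N <= w -> mult G u w = 0) ->
  degree_in (incident_edges G u N) u = \sum_(w < N) mult G u w + mult G u u.
Proof.
move=> far0; rewrite /degree_in big_allpairs_dep /=.
have toward w : \sum_(i <- iota 0 (mult G u w))
    incidence u (minn u w, maxn u w, i) = mult G u w + (w == u) * mult G u w.
  rewrite (eq_bigr (fun=> 1 + (w == u))) => [|i _].
    by rewrite big_const_seq count_predT size_iota iter_addn_0 mulnDl mul1n.
  by rewrite /incidence /=; lia.
under eq_bigr do rewrite toward.
rewrite big_split /= -[N in iota 0 N]subn0 !big_mkord; congr (_ + _).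
have [lt_uN|le_Nu] := ltnP u N.
  rewrite (bigD1 (Ordinal lt_uN)) //= eqxx mul1n big1 ?addn0 // => w.
  by rewrite -val_eqE /= => /negbTE->.
by rewrite far0 // big1 // => w _; have := ltn_ord w; case: eqP => //; lia.
Qed.

Definition covers (G : multigraph) (u : nat) (L : seq edge) : Prop :=
  [/\ uniq L, forall e, e \in L -> edges G e &
      forall e, edges G e -> 0 < incidence u e -> e \in L].

Lemma has_degree_covers G u d : has_degree G u d ->
  exists2 L, covers G u L & degree_in L u = d.
Proof.
move=> [N [far0 ->]]; have memL := mem_incident_edges _ far0.
exists (incident_edges G u N); last exact: degree_incident_edges.
split; first exact: uniq_incident_edges.
  by move=> e /memL[].
by move=> e eG eu; exact/memL.
Qed.

Lemma covers_degree G u L M :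
  covers G u L -> covers G u M -> degree_in L u = degree_in M u.
Proof.
move=> [uL LG Lu] [uM MG Mu]; apply: eq_degree_in => // e eu.
by apply/idP/idP => [/LG eG|/MG eG]; [exact: Mu | exact: Lu].
Qed.

Lemma has_degree_unique G u d d' :
  has_degree G u d -> has_degree G u d' -> d = d'.
Proof.
by move=> /has_degree_covers[L cL <-] /has_degree_covers[M cM <-];
  exact: covers_degree cL cM.
Qed.

Definition odd_vertex (G : multigraph) (u : nat) : Prop :=
  vert G u /\ exists2 d, has_degree G u d & odd d.

Lemma odd_vertex_degree G u d : vert G u -> has_degree G u d ->
  odd_vertex G u <-> odd d.
Proof.
move=> vu ud; split=> [[_ [d' ud']]|od].
  by rewrite (has_degree_unique ud' ud).
by split=> //; exists d.
Qed.

Lemma odd_vertex_covers G u L : locally_finite G -> covers G u L ->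
  odd_vertex G u <-> odd (degree_in L u).
Proof.
move=> lfG cL; split=> [[_ [d /has_degree_covers[M cM <-]]]|oL].
  by rewrite (covers_degree cM cL).
have [e eL eu] := degree_in_gt0 (odd_gt0 oL).
have vu : vert G u by apply: edge_vert eu; case: cL => _ + _; exact.
have [d ud] := lfG u vu; apply/(odd_vertex_degree vu ud).
by have [M cM <-] := has_degree_covers ud; rewrite (covers_degree cM cL).
Qed.

Lemma finite_star G u : locally_finite G -> finite_set (star G u).
Proof.
move=> lfG; have [vu|nvu] := boolP (vert G u).
  have [d /has_degree_covers[L [_ _ Lu] _]] := lfG u vu.
  by apply: sub_finite_set (finite_seq L) => e [eG eu]; exact: Lu.
rewrite (_ : star G u = set0) //; apply/seteqP; split=> // e [eG eu].
by case/negP: nvu; exact: edge_vert eu.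
Qed.

(** * Eulerian paths and trails *)

Lemma walk_mkseq (v : nat -> nat) (x : nat -> edge) n :
  (forall k, joins (x k) (v k) (v k.+1)) ->
  walk (v 0) (mkseq x n) /\ walk_end (v 0) (mkseq x n) = v n.
Proof.
move=> xv; elim: n => // n [wn en]; have /joinsP[xn opp] := xv n.
by rewrite mkseqS -cats1 walk_cat walk_end_cat wn en /= xn opp.
Qed.

Lemma one_way_eulerianP G : one_way_eulerian G <->
  exists r x, (forall n, trail (edges G) r (mkseq x n)) /\ edges G `<=` range x.
Proof.
split=> [[v [x [xv xG]]]|[r [x [tx xG]]]].
  exists (v 0), x; split=> [n|e /xG[n [<- _]]]; last by exists n.
  split; last by case: (walk_mkseq n (fun k => (xv k).2)).
    apply: mkseq_uniq => k l xkl; have [m [_ um]] := xG _ (xv k).1.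
    by rewrite -(um l (esym xkl)) -(um k).
  by move=> e /mapP[k _ ->]; exact: (xv k).1.
have step n : edges G (x n) /\ 0 < incidence (walk_end r (mkseq x n)) (x n).
  have := tx n.+1; rewrite mkseqS -cats1 => /trail_cat[_ [_ xE /andP[xn _]]].
  by split=> //; have [] := xE (x n) (mem_head _ _).
exists (fun n => walk_end r (mkseq x n)), x; split=> [n|e /xG[n _ <-]].
  have [Gxn xn] := step n; split=> //.
  by rewrite mkseqS -cats1 walk_end_cat; exact: joins_opposite.
exists n; split=> // m xnm; have [ux _ _] := tx (maxn n m).+1.
by apply: (mkseq_uniqP x _ ux) => //; rewrite inE ltnS ?leq_maxl ?leq_maxr.
Qed.

Lemma finite_sub_range_mkseq (T : eqType) (x : nat -> T) (A : set T) :
  finite_set A -> A `<=` range x -> exists n, forall a, A a -> a \in mkseq x n.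
Proof.
move=> /finite_seqP[s ->]; elim: s => [|a s IHs] sx; first by exists 0.
have [|n sn] := IHs; first by move=> b bs; apply: sx; rewrite /= inE bs orbT.
have [k _ xk] : range x a by apply: sx; exact: mem_head.
exists (maxn k.+1 n) => b; rewrite /= inE => /predU1P[->|/sn /mapP[l]].
  by rewrite -xk; apply: map_f; rewrite mem_iota leq_maxl.
by rewrite mem_iota => ltn ->; apply: map_f; rewrite mem_iota; lia.
Qed.

Lemma eulerian_unique_odd_vertex G : locally_finite G -> one_way_eulerian G ->
  exists r, forall u, odd_vertex G u <-> u = r.
Proof.
move=> lfG /one_way_eulerianP[r [x [tx xG]]]; exists r => u.
have [|n xn] := finite_sub_range_mkseq (finite_star u lfG) (x := x).
  by move=> e [/xG].
have [ux xE wx] := tx n.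
have covx : covers G u (mkseq x n) by split=> // e eG eu; exact: xn.
have end_neq : (u == walk_end r (mkseq x n)) = false.
  apply/negP => /eqP end_u.
  have := tx n.+1; rewrite mkseqS -cats1 => /trail_cat[_ [_ xnE]].
  have [Gxn xn_notin] := xnE _ (mem_head _ _); rewrite -end_u /= andbT => xnu.
  by apply: xn_notin; exact: xn.
rewrite (odd_vertex_covers lfG covx) (odd_degree_walk _ wx) end_neq addbF.
by split=> /eqP.
Qed.

(** * Eulerian paths in one-ended graphs *)

Definition unreached (E : set edge) (b : nat) : set edge :=
  [set e | E e /\ ~ reach E b e.1.1].

Lemma set_seq_cat (T : eqType) (s1 s2 : seq T) :
  [set` s1 ++ s2] = [set` s1] `|` [set` s2].
Proof.
apply/seteqP; split=> x /=; first by rewrite mem_cat => /orP.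
by move=> [] xs; rewrite mem_cat xs ?orbT.
Qed.

Lemma finite_uniq_seq (T : eqType) (A : set T) :
  finite_set A -> exists2 s, uniq s & forall x, x \in s <-> A x.
Proof.
move=> /finite_seqP[s ->]; exists (undup s); first exact: undup_uniq.
by move=> x; rewrite mem_undup.
Qed.

Lemma connected_from_absorb E a T (E' := E `\` [set` T]) (b := walk_end a T) :
  connected_from E a -> trail E a T ->
  connected_from ([set` T] `|` unreached E' b) a.
Proof.
move=> cE [uT TE wT]; set K := _ `|` _.
have reachT e u : e \in T -> 0 < incidence u e -> reach K a u.
  move=> eT eu; apply: (visits_reach (T := T)).
    by split=> // f fT; left.
  exact: walk_visits wT eT eu.
pose X u := reach K a u \/ reach E' b u.
have X_edge f : E f -> (X f.1.1 <-> X f.1.2).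
  move=> Ef; have [fT|/negP fT] := boolP (f \in T).
    have [f1 f2] := (incidence_end1 f, incidence_end2 f).
    by split=> _; left; exact: reachT fT _.
  have E'f : E' f by [].
  have [b1|b1] := EM (reach E' b f.1.1).
    by split=> _; right => //; exact/(reach_edge b E'f).
  have Kf : K f by right.
  by split=> -[/(reach_edge a Kf)|/(reach_edge b E'f)]; [left|right|left|right].
move=> e [eT|[[Ee _] nb]]; first exact: reachT eT (incidence_end1 e).
have /(reach_closed X_edge)[Xe _] := cE e Ee.
by case: Xe => //; left; exact: reach_refl.
Qed.

Lemma connected_from_setD_unreached E b :
  connected_from (E `\` unreached E b) b.
Proof.
set K := _ `\` _ => e [Ee ne].
have reached : reach E b e.1.1 by apply: contrapT => nb; apply: ne.
have K_edge f : E f -> (reach E b f.1.1 /\ reach K b f.1.1 <->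
                         reach E b f.1.2 /\ reach K b f.1.2).
  move=> Ef; have Eb := reach_edge b Ef.
  have [b1|nb1] := EM (reach E b f.1.1); last first.
    by split=> -[b_f]; case: nb1 => //; exact/Eb.
  have Kf : K f by split=> // -[].
  have Kb := reach_edge b Kf.
  by split=> -[b_f k_f]; split; [exact/Eb | exact/Kb | exact/Eb | exact/Kb].
have /(reach_closed (X := fun u => reach E b u /\ reach K b u) K_edge)[be _] :=
  reached.
by case: be => //; split; exact: reach_refl.
Qed.

Lemma reach_removed E a (P : seq edge) e :
  connected_from E a -> (E `\` [set` P]) e ->
  exists2 p, p \in a :: [seq f.1.1 | f <- P] ++ [seq f.1.2 | f <- P] &
             reach (E `\` [set` P]) p e.1.1.
Proof.
set ps := a :: _; set E' := E `\` _ => cE [Ee _].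
pose X u := exists2 p, p \in ps & reach E' p u.
have X_edge f : E f -> (X f.1.1 <-> X f.1.2).
  move=> Ef; have [fP|/negP fP] := boolP (f \in P).
    split=> _; [exists f.1.2|exists f.1.1]; try exact: reach_refl.
      by rewrite inE mem_cat (map_f (fun f : edge => f.1.2)) ?orbT.
    by rewrite inE mem_cat (map_f (fun f : edge => f.1.1)) ?orbT.
  by split=> -[p pps /(reach_edge p (conj Ef fP))]; exists p.
have /(reach_closed X_edge)[Xe _] := cE e Ee; apply: Xe.
by exists a; [exact: mem_head | exact: reach_refl].
Qed.

Lemma vert_reach G E u v :
  E `<=` edges G -> reach E u v -> (vert G u <-> vert G v).
Proof.
move=> EG; apply: (reach_closed (X := fun w => vert G w)) => e /EG eG.
by split=> _; [exact: edge_vert (incidence_end2 e)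
              |exact: edge_vert (incidence_end1 e)].
Qed.

Lemma card_le_I1_eq T (A : set T) x y : A #<= `I_1 -> A x -> A y -> x = y.
Proof.
move=> /card_le_natP[f injf ltf] Ax Ay; apply: injf; rewrite ?inE //.
by move: (ltf _ Ax) (ltf _ Ay); rewrite !ltnS !leqn0 => /eqP-> /eqP->.
Qed.

Lemma one_end_infinite_reach G (F : seq edge) u v :
  number_of_ends G 1 -> (forall e, e \in F -> edges G e) ->
  vert G u -> vert G v ->
  infinite_set (reach (edges G `\` [set` F]) u) ->
  infinite_set (reach (edges G `\` [set` F]) v) ->
  reach (edges G `\` [set` F]) u = reach (edges G `\` [set` F]) v.
Proof.
move=> [endG _] FG vu vv infu infv.
apply: (card_le_I1_eq (endG [set` F] (finite_seq F) FG)); split=> //.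
  by exists u; rewrite ?component_reach.
by exists v; rewrite ?component_reach.
Qed.

(* Every component left by removing P contains a or an end of an edge of P, so
   there are finitely many of them, and all but one are finite. *)
Lemma finite_unreached G (T P : seq edge) a b
    (E := edges G `\` [set` T]) (E' := edges G `\` [set` T ++ P]) :
  locally_finite G -> number_of_ends G 1 ->
  (forall e, e \in T ++ P -> edges G e) -> connected_from E a ->
  vert G b -> infinite_set (reach E' b) -> finite_set (unreached E' b).
Proof.
move=> lfG endG TPG cE vb infb.
have E'E : E' = E `\` [set` P].
  by rewrite /E' /E set_seq_cat setDDl.
pose ps := a :: [seq f.1.1 | f <- P] ++ [seq f.1.2 | f <- P].
pose D := [set p | p \in ps /\ finite_set (reach E' p)].
have finD : finite_set D by apply: sub_finite_set (finite_seq ps) => p [].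
apply: (@sub_finite_set _ _ (\bigcup_(p in D) \bigcup_(u in reach E' p)
    star G u)); last first.
  apply: bigcup_finite => // p [_ finp]; apply: bigcup_finite => // u _.
  exact: finite_star.
move=> e [E'e nb]; have [p pps pe] : exists2 p, p \in ps & reach E' p e.1.1.
  by rewrite E'E; apply: reach_removed; rewrite -?E'E.
have [eG _] := E'e; have ve := edge_vert eG (incidence_end1 e).
have finp : finite_set (reach E' p).
  apply: contrapT; rewrite (reach_eq pe) => infe; apply: nb.
  rewrite (one_end_infinite_reach endG TPG vb ve infb infe).
  exact: reach_refl.
exists p => //; exists e.1.1 => //; split=> //; exact: incidence_end1.
Qed.

Lemma eulerian_of_trails G r (T : nat -> seq edge) :
  (forall k, trail (edges G) r (T k)) -> (forall k, prefix (T k) (T k.+1)) ->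
  (forall k, k <= size (T k)) -> (forall e, edges G e -> exists k, e \in T k) ->
  one_way_eulerian G.
Proof.
move=> tT preT sizeT memT.
have {}preT : {homo T : m n / m <= n >-> prefix m n}.
  exact: homo_leq (@prefix_refl _) (@prefix_trans _) preT.
pose x n := nth (0, 0, 0) (T n.+1) n.
have nthT k n : n < size (T k) -> nth (0, 0, 0) (T k) n = x n.
  move=> lt_nT; have lt_nT' := sizeT n.+1; rewrite /x.
  by have [/preT|/ltnW/preT] := leqP k n.+1;
    move=> /prefixP[s ->]; rewrite nth_cat ?lt_nT ?lt_nT'.
have mkseqE n : mkseq x n = take n (T n).
  apply: (@eq_from_nth _ (0, 0, 0)) => [|i].
    by rewrite size_mkseq size_takel.
  rewrite size_mkseq => lt_in; rewrite nth_mkseq // nth_take // nthT //.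
  exact: leq_trans lt_in (sizeT n).
apply/one_way_eulerianP; exists r, x; split=> [n|e /memT[k ek]].
  by have := tT n; rewrite -{1}(cat_take_drop n (T n)) mkseqE => /trail_cat[].
by exists (index e (T k)) => //; rewrite -(nthT k) ?index_mem ?nth_index.
Qed.

Section UniqueOddVertex.
Variables (G : multigraph) (r : nat).
Hypotheses (lfG : locally_finite G) (endG : number_of_ends G 1).
Hypothesis oddG : forall u, odd_vertex G u <-> u = r.

Lemma odd_degree_off_trail F S u : trail (edges G) r F -> uniq S ->
  (forall e, e \in S -> (edges G `\` [set` F]) e) ->
  (forall e, (edges G `\` [set` F]) e -> 0 < incidence u e -> e \in S) ->
  odd (degree_in S u) = (u == walk_end r F).
Proof.
move=> [uF FG wF] uS SE Su.
have covFS : covers G u (F ++ S).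
  split=> [|e|e eG eu].
  - rewrite cat_uniq uF uS andbT.
    by apply/hasPn => e /SE[_ /negP].
  - by rewrite mem_cat => /orP[/FG|/SE[]].
  - rewrite mem_cat; have [//|/negP eF] := boolP (e \in F).
    exact: Su.
have : odd (degree_in (F ++ S) u) = (u == r).
  by apply/idP/eqP => [/(odd_vertex_covers lfG covFS)/oddG|/oddG
    /(odd_vertex_covers lfG covFS)].
rewrite degree_in_cat oddD (odd_degree_walk _ wF).
by case: (u == r) (u == walk_end r F) (odd _) => -[] [].
Qed.

Lemma trail_end_vert F : trail (edges G) r F -> vert G (walk_end r F).
Proof.
move=> [_ FG wF]; have [vr _] := (oddG r).2 erefl.
exact/(vert_reach (@subset_refl _ _) (walk_reach FG wF)).
Qed.

(* Off a trail from r, the degrees of the remaining edges are even except at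
   the end of the trail; so the handshake lemma fails on its component if that
   is finite. *)
Lemma trail_end_infinite F : trail (edges G) r F ->
  infinite_set (reach (edges G `\` [set` F]) (walk_end r F)).
Proof.
move=> tF; set b := walk_end r F; set E := _ `\` _.
move=> /finite_uniq_seq[us uus usP].
have [L uL LP] :
    exists2 L, uniq L & forall e, e \in L <-> E e /\ e.1.1 \in us.
  apply: (@finite_uniq_seq _ [set e | E e /\ e.1.1 \in us]).
  apply: (@sub_finite_set _ _ (\bigcup_(u in [set` us]) star G u)).
    move=> e [[eG _] e1]; exists e.1.1 => //.
    by split=> //; exact: incidence_end1.
  by apply: bigcup_finite => // u _; exact: finite_star.
have odd_L u : u \in us -> odd (degree_in L u) = (b == u).
  move=> u_us; rewrite (odd_degree_off_trail tF uL) 1?eq_sym // => e.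
    by case/LP.
  by move=> Ee eu; apply/LP; split=> //; apply/usP/(reach_incident b Ee eu)/usP.
have b_us : b \in us by apply/usP; exact: reach_refl.
have /(congr1 odd) : \sum_(u <- us) degree_in L u = (size L).*2.
  apply: handshake => // e /LP[Ee e1]; split=> //.
  by apply/usP/(reach_edge b Ee)/usP.
rewrite odd_double (big_morph odd oddD (erefl _)).
rewrite (eq_big_seq (fun u => odd (b == u))) => [|u /odd_L->].
  by rewrite -(big_morph odd oddD (erefl _)) sum_eq_uniq.
by rewrite oddb.
Qed.

Lemma even_degree_unreached F (b := walk_end r F) (S : seq edge) u :
  trail (edges G) r F -> uniq S ->
  (forall e, e \in S <-> unreached (edges G `\` [set` F]) b e) ->
  odd (degree_in S u) = false.
Proof.
move=> tF uS SP; set E := _ `\` _ in SP.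
apply/negbTE/negP => oS; have [e /SP[Ee nbe] eu] := degree_in_gt0 (odd_gt0 oS).
have nbu : ~ reach E b u by move/(reach_incident b Ee eu).
move: oS; rewrite (odd_degree_off_trail tF uS) => [/eqP ub|f /SP[]//|f Ef fu].
  by apply: nbu; rewrite ub; exact: reach_refl.
by apply/SP; split=> // /(reach_incident b Ef fu).
Qed.

Definition extendable (T : seq edge) : Prop :=
  trail (edges G) r T /\
  connected_from (edges G `\` [set` T]) (walk_end r T).

(* The edges that a trail P cuts off from its end are finitely many and have
   even degrees, so together with P they have an Eulerian trail with the same
   ends. *)
Lemma absorb_unreached T P (a := walk_end r T) :
  extendable T -> trail (edges G) r (T ++ P) ->
  exists Q, [/\ trail (edges G `\` [set` T]) a Q, walk_end a Q = walk_end a P &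
    [set` Q] = [set` P] `|`
               unreached (edges G `\` [set` T ++ P]) (walk_end r (T ++ P))].
Proof.
move=> [tT cT] tTP; have [_ tP] := (trail_cat _ _ _ _).1 tTP.
set E := edges G `\` [set` T] in cT tP *; set b := walk_end r _.
have bE : b = walk_end a P by rewrite /b walk_end_cat.
have [S uS SP] : exists2 S, uniq S &
    forall e, e \in S <-> unreached (edges G `\` [set` T ++ P]) b e.
  have [_ TPG _] := tTP.
  apply/finite_uniq_seq/(finite_unreached lfG endG TPG cT).
    exact: trail_end_vert.
  exact: trail_end_infinite.
have SE e : e \in S -> (E `\` [set` P]) e.
  by rewrite setDDl -set_seq_cat => /SP[].
have PSE : [set` P ++ S] = [set` P] `|` unreached (edges G `\` [set` T ++ P]) b.
  by rewrite set_seq_cat; congr setU; apply/seteqP; split=> e /SP.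
have [uP PE wP] := tP.
have uPS : uniq (P ++ S).
  by rewrite cat_uniq uP uS andbT; apply/hasPn => e /SE[_ /negP].
have oddPS : odd_exactly_at_ends (P ++ S) a b.
  move=> u; rewrite degree_in_cat oddD (odd_degree_walk _ wP) -bE.
  by rewrite (even_degree_unreached _ tTP uS SP) addbF.
have cPS : connected_from [set` P ++ S] a.
  by rewrite PSE bE set_seq_cat -setDDl; exact: connected_from_absorb.
have [Q [perQ wQ endQ]] := euler_trail uPS oddPS cPS.
exists Q; rewrite endQ -bE -PSE; split=> //.
  split=> // [|e]; first by rewrite (perm_uniq perQ).
  by rewrite (perm_mem perQ) mem_cat => /orP[/PE|/SE[]].
by apply/seteqP; split=> e /=; rewrite (perm_mem perQ).
Qed.

Lemma extendable_through T e : extendable T -> (edges G `\` [set` T]) e ->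
  exists2 Q, extendable (T ++ Q) & e \in Q.
Proof.
move=> extT Ee; have [tT cT] := extT; have [P tP eP] := trail_through cT Ee.
have tTP : trail (edges G) r (T ++ P) by exact/trail_cat.
have [Q [tQ endQ QE]] := absorb_unreached extT tTP.
exists Q; last by have : [set` Q] e by rewrite QE; left.
split; first exact/trail_cat.
rewrite walk_end_cat endQ -walk_end_cat.
rewrite set_seq_cat QE setUA -set_seq_cat -setDDl.
exact: connected_from_setD_unreached.
Qed.

Lemma extendable_next T e : extendable T ->
  exists Q, [/\ Q != [::], extendable (T ++ Q) & edges G e -> e \in T ++ Q].
Proof.
move=> extT; have [f Ef fe] : exists2 f, (edges G `\` [set` T]) f &
    edges G e -> e \in T \/ e = f.
  have [Ee|nEe] := EM ((edges G `\` [set` T]) e); first by exists e; auto.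
  have [f Ef] : exists f, (edges G `\` [set` T]) f.
    apply: contrapT => none; have [tT _] := extT.
    apply: (trail_end_infinite tT).
    apply: sub_finite_set (finite_set1 (walk_end r T)) => u.
    move=> /(reach_closed (X := fun v => v = walk_end r T))[] => [f Ef|-> //].
    by case: none; exists f.
  by exists f => // eG; left; apply: contraT => /negP eT; case: nEe.
have [Q extQ fQ] := extendable_through extT Ef.
exists Q; split=> //; first by case: (Q) fQ.
by move=> /fe[eT|->]; rewrite mem_cat ?eT // fQ orbT.
Qed.

Lemma extendable_nil : connected G -> extendable [::].
Proof.
move=> cG; split=> // e [eG _]; have [vr _] := (oddG r).2 erefl.
rewrite set_nil -component_reach; apply: cG => //.
exact: edge_vert (incidence_end1 e).
Qed.

Lemma unique_odd_vertex_eulerian : connected G -> one_way_eulerian G.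
Proof.
move=> cG.
have /choice[next nextP] : forall p : seq edge * edge, exists Q,
    extendable p.1 ->
    [/\ Q != [::], extendable (p.1 ++ Q) & edges G p.2 -> p.2 \in p.1 ++ Q].
  move=> [T e]; have [extT|] := EM (extendable T); last by exists [::].
  by have [Q] := extendable_next e extT; exists Q.
pose e k : edge := odflt (0, 0, 0) (unpickle k).
pose T := fix T k := if k is k'.+1 then T k' ++ next (T k', e k') else [::].
have extT k : extendable (T k).
  elim: k => [|k IHk]; first exact: extendable_nil.
  by have [] := nextP (T k, e k) IHk.
apply: (@eulerian_of_trails G r T) => [k|k|k|f fG].
- by have [] := extT k.
- exact: prefix_prefix.
- elim: k => //= k IHk; have [next_neq0 _ _] := nextP (T k, e k) (extT k).
  by rewrite size_cat -addn1 leq_add // lt0n size_eq0.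
- exists (pickle f).+1.
  have [_ _] := nextP (T (pickle f), e (pickle f)) (extT _).
  by rewrite /= /e pickleK; exact.
Qed.

End UniqueOddVertex.

Definition connected_one_ended (G : multigraph) : Prop :=
  [/\ connected G, locally_finite G & number_of_ends G 1].

Lemma eulerian_iff_unique_odd_vertex G : connected_one_ended G ->
  one_way_eulerian G <-> exists! r, odd_vertex G r.
Proof.
move=> [cG lfG endG].
split=> [/(eulerian_unique_odd_vertex lfG)[r oddG]|[r [or ur]]].
  by exists r; split=> [|u /oddG]; [exact/oddG | exact: esym].
apply: (@unique_odd_vertex_eulerian G r) => // u.
by split=> [/ur|->].
Qed.

(** * The two reductions *)

Lemma exists_unique_below (p : pred nat) : (exists! n, p n) <->
  (exists n, p n) /\ ~ exists n, p n && exists_below n p.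
Proof.
split=> [[n [pn un]]|[[n pn] none]].
  split; first by exists n.
  move=> [m /andP[/un <- /exists_belowP[k lt_kn /un e_nk]]].
  by rewrite e_nk ltnn in lt_kn.
exists n; split=> // m pm; case: (ltngtP n m) => // lt; case: none.
  by exists m; rewrite pm; apply/exists_belowP; exists n.
by exists n; rewrite pn; apply/exists_belowP; exists m.
Qed.

Lemma Sigma2inv_eulerian (G : nat -> multigraph) :
  uniformly_highly_computable G -> (forall e, connected_one_ended (G e)) ->
  Sigma2inv [set e | one_way_eulerian (G e)].
Proof.
move=> [_ [V [E [deg [[cV _ cdeg] [VE _ degP]]]]]] oneG.
pose p e v := (V e v == 1) && odd (deg e v).
have pP e v : p e v <-> odd_vertex (G e) v.
  rewrite /p VE eqb1; split=> [/andP[vv]|ov].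
    by move/(odd_vertex_degree vv (degP e v vv)).
  have vv : vert (G e) v by case: ov.
  by rewrite vv; exact/(odd_vertex_degree vv (degP e v vv)).
rewrite (_ : [set e | _] =
    ce_difference p (fun e v => p e v && exists_below v (p e))).
  by apply: Sigma2inv_ce_difference; rewrite /p; computability.
apply/seteqP; split=> e /=.
  move=> /(eulerian_iff_unique_odd_vertex (oneG e))[r [/pP pr ur]].
  by apply/exists_unique_below; exists r; split=> // v /pP; exact: ur.
move=> /exists_unique_below[r [/pP pr ur]].
apply/(eulerian_iff_unique_odd_vertex (oneG e)).
by exists r; split=> // v /pP; exact: ur.
Qed.

Definition ray_mult (h : nat -> nat) (u v : nat) : nat :=
  (v == u.+1) * h u + (u == v.+1) * h v.

Lemma ray_mult_sym h u v : ray_mult h u v = ray_mult h v u.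
Proof. exact: addnC. Qed.

Definition ray (h : nat -> nat) : multigraph :=
  @Multigraph predT (ray_mult h) (ray_mult_sym h) (fun _ _ _ => isT).

Definition ray_degree (h : nat -> nat) (n : nat) : nat :=
  (0 < n) * h n.-1 + h n.

Lemma ray_mult0 h u v : v != u.+1 -> u != v.+1 -> ray_mult h u v = 0.
Proof. by rewrite /ray_mult => /negbTE-> /negbTE->. Qed.

Lemma ray_multS h n : ray_mult h n n.+1 = h n.
Proof.
by rewrite /ray_mult eqxx mul1n (_ : (n == n.+2) = false) ?addn0 //; lia.
Qed.

Lemma has_degree_ray h n : has_degree (ray h) n (ray_degree h n).
Proof.
exists n.+2; split=> [w lt_nw|] /=; first by apply: ray_mult0; lia.
have loop0 : ray_mult h n n = 0 by apply: ray_mult0; lia.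
rewrite !big_ord_recr /= loop0 ray_multS !addn0 /ray_degree; congr (_ + _).
case: n {loop0} => [|n]; first by rewrite big_ord0.
rewrite big_ord_recr /= ray_mult_sym ray_multS mul1n big1 // => i _.
by apply: ray_mult0; have := ltn_ord i; lia.
Qed.

Section PositiveRay.
Variable h : nat -> nat.
Hypothesis h_gt0 : forall n, 0 < h n.

Lemma ray_edge n : edges (ray h) (n, n.+1, 0).
Proof. by split=> //=; rewrite ray_multS. Qed.

Lemma reach_ray_tail (F : set edge) N n :
  (forall e, F e -> e.1.1 < N) -> N <= n -> reach (edges (ray h) `\` F) N n.
Proof.
move=> FN /subnKC <-; elim: (n - N) => [|k IHk].
  by rewrite addn0; exact: reach_refl.
rewrite addnS; have Ee : (edges (ray h) `\` F) (N + k, (N + k).+1, 0).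
  by split; [exact: ray_edge | move=> /FN /=; lia].
exact/(reach_edge N Ee).
Qed.

Lemma component_ray u v : component (ray h) set0 u v.
Proof.
have from0 n : component (ray h) set0 0 n.
  by rewrite component_reach; exact: reach_ray_tail.
move: (from0 u) (from0 v); rewrite !component_reach => /reach_sym.
exact: reach_trans.
Qed.

Lemma infinite_component_ray (F : set edge) N C :
  (forall e, F e -> e.1.1 < N) ->
  infinite_components (ray h) F C -> C = component (ray h) F N.
Proof.
move=> FN [infC [v _ CE]]; have [w Cw le_Nw] : exists2 w, C w & N <= w.
  apply: contrapT => none; apply: infC; apply: sub_finite_set (finite_II N).
  by move=> w Cw /=; rewrite ltnNge; apply/negP => le_Nw; apply: none; exists w.
rewrite CE !component_reach in Cw *.
by rewrite (reach_eq Cw) (reach_eq (reach_ray_tail FN le_Nw)).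
Qed.

Lemma number_of_ends_ray : number_of_ends (ray h) 1.
Proof.
split=> [F /finite_seqP[s ->] _|].
  have sN (e : edge) : e \in s -> e.1.1 < (\max_(e <- s) (e : edge).1.1).+1.
    by move=> es; rewrite ltnS; exact: leq_bigmax_seq.
  apply/card_le_natP; exists (fun=> 0) => // C D; rewrite !inE.
  by move=> /(infinite_component_ray sN)-> /(infinite_component_ray sN)->.
exists set0; split=> //.
apply: card_le_trans (card_image_le (fun=> 0) _); apply: subset_card_le.
move=> [|//] _; exists setT => //; split; first exact: infinite_nat.
by exists 0 => //; apply/seteqP; split=> // n _; exact: component_ray.
Qed.

Lemma connected_one_ended_ray : connected_one_ended (ray h).
Proof.
split; last exact: number_of_ends_ray.
- by move=> u v _ _; exact: component_ray.
- by move=> n _; exists (ray_degree h n); exact: has_degree_ray.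
Qed.

End PositiveRay.

Lemma uniformly_highly_computable_ray (h : nat -> nat -> nat) :
  computable2 h -> uniformly_highly_computable (fun e => ray (h e)).
Proof.
move=> ch; split=> [e n _|].
  by exists (ray_degree (h e) n); exact: has_degree_ray.
exists (fun _ _ => 1), (fun e => ray_mult (h e)), (fun e => ray_degree (h e)).
split; split=> //; last by move=> e v _; exact: has_degree_ray.
- computability.
- rewrite /ray_mult; computability.
- rewrite /ray_degree; computability.
Qed.

Lemma odd_vertex_ray h u : odd_vertex (ray h) u <-> odd (ray_degree h u).
Proof. exact: odd_vertex_degree (has_degree_ray h u). Qed.

(* The vertex 0 has degree 2 and the vertex n + 1 has degree
   4 - f n - f (n + 1). *)
Lemma eulerian_ray_single_change (f : nat -> bool) : f 0 = false ->
  one_way_eulerian (ray (fun n => 2 - f n)) <-> exists! k, f k <> f k.+1.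
Proof.
set h := fun n => _; move=> f0.
have h_gt0 n : 0 < h n by rewrite /h; case: (f n).
have odd0 : ~ odd_vertex (ray h) 0 by rewrite odd_vertex_ray /ray_degree /h f0.
have oddS k : odd_vertex (ray h) k.+1 <-> f k <> f k.+1.
  by rewrite odd_vertex_ray /ray_degree /h /=; case: (f k) (f k.+1) => -[].
rewrite (eulerian_iff_unique_odd_vertex (connected_one_ended_ray h_gt0)).
split=> [[[|k] [// /oddS ck uk]]|[k [ck uk]]].
  by exists k; split=> // l cl; have [] := uk l.+1 ((oddS l).2 cl).
exists k.+1; split=> [|[|l] odd_l]; [exact/oddS | by case: odd0 |].
by rewrite (uk l ((oddS l).1 odd_l)).
Qed.

Lemma Sigma2inv_realized_by_rays (W : set nat) : Sigma2inv W ->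
  exists G : nat -> multigraph,
    [/\ uniformly_highly_computable G, forall e, connected_one_ended (G e) &
        W = [set e | one_way_eulerian (G e)]].
Proof.
move=> [f [cf f0 limf card2]].
exists (fun e => ray (fun n => 2 - f e n)); split.
- by apply: uniformly_highly_computable_ray; computability.
- by move=> e; apply: connected_one_ended_ray => n; case: (f e n).
- have WE e : W e <-> one_way_eulerian (ray (fun n => 2 - f e n)).
    rewrite (eulerian_ray_single_change (f0 e)) -(single_change (f0 e)).
    exact: two_changes_limit (f0 e) (limf e) (card2 e).
  by apply/seteqP; split=> e /WE.
Qed.

Theorem theorem4p4 :
  (forall G : nat -> multigraph,
     uniformly_highly_computable G ->
     (forall e, [/\ connected (G e), locally_finite (G e) &
                    number_of_ends (G e) 1]) ->
     Sigma2inv [set e | one_way_eulerian (G e)]) /\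
  (forall W : set nat,
     Sigma2inv W ->
     exists G : nat -> multigraph,
       [/\ uniformly_highly_computable G,
           forall e, [/\ connected (G e), locally_finite (G e) &
                         number_of_ends (G e) 1] &
           W = [set e | one_way_eulerian (G e)]]) /\
  (exists G : nat -> multigraph,
     [/\ uniformly_highly_computable G,
         forall e, [/\ connected (G e), locally_finite (G e) &
                       number_of_ends (G e) 1] &
         Sigma2inv_complete [set e | one_way_eulerian (G e)]]).
Proof.
split; first exact: Sigma2inv_eulerian.
split; first exact: Sigma2inv_realized_by_rays.
have [univ_Sigma univ_hard] := Sigma2inv_complete_universal.
have [G [cG oneG univE]] := Sigma2inv_realized_by_rays univ_Sigma.
by exists G; split=> //; rewrite -univE.
Qed.
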